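(* For any finite field $\mathbb{F}$ of order $q$ and positive integer $k$, if $M$ is an excluded minor for the class of $\mathbb{F}$-representable matroids and $M$ has branch-width $k$, then $|M|\le \mathrm{tower}(3,q,q,k,6)$.
   Context: $|M|$ denotes the number of elements of the ground set of the matroid $M$. For $X\subseteq E(M)$, $\lambda_M(X)=r_M(X)+r_M(E(M)-X)-r_M(E(M))$. An excluded minor for a minor-closed class of matroids is a matroid not in the class all of whose proper minors are in the class. $\mathrm{tower}(a_1,\ldots,a_n)=a_1^{a_2^{\cdot^{\cdot^{a_n}}}}$ (iterated exponentiation, evaluated from the top), so $\mathrm{tower}(3,q,q,k,6)=3^{q^{q^{k^6}}}$. Branch-width: A tree is cubic if all its internal vertices have degree $3$; its leaves are its degree-$1$ vertices. For a matroid $M$ with $|M|\ge 2$, a branch-decomposition of $M$ is a cubic tree $T$ whose leaves are bijectively labelled by the elements of $M$. The width of an edge $e$ of $T$ is $\lambda_M(X)+1$, where $X$ is the set of labels of the leaves in one of the two components of $T\setminus e$. The width of $T$ is the maximum of the widths of its edges. The branch-width of $M$ is the minimum width over all branch-decompositions of $M$. If $|M|\le 1$, the branch-width of $M$ is $|M|$. *)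

(* Defs.v *)
From HB Require Import structures.
From mathcomp Require Import all_boot all_order all_algebra.

Set Implicit Arguments.
Unset Strict Implicit.
Unset Printing Implicit Defensive.

(* The ground set is a subset of an ambient finite type, so that the minors   *)
(* of a matroid live over the same type.                                      *)
Record matroid (T : finType) := Matroid {
  ground : {set T};
  indep : {set {set T}};
  indep_ground : forall I, I \in indep -> I \subset ground;
  indep_set0 : set0 \in indep;
  indep_sub : forall I J : {set T}, I \subset J -> J \in indep -> I \in indep;
  indep_aug : forall I J : {set T}, I \in indep -> J \in indep ->
    #|I| < #|J| -> exists2 x, x \in J :\: I & x |: I \in indep
}.

Section Matroids.
Variable T : finType.
Implicit Types (M N : matroid T) (B C D I J X : {set T}).

Definition rank M X : nat := \max_(I in indep M | I \subset X) #|I|.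

(* The truncated subtraction is harmless, by submodularity of the rank. *)
Definition connectivity M X : nat :=
  rank M X + rank M (ground M :\: X) - rank M (ground M).

Definition basis_in M X B : bool :=
  maxset (fun I => (I \in indep M) && (I \subset X)) B.

Lemma basis_in_card_le M X I B :
  I \in indep M -> I \subset X -> basis_in M X B -> #|I| <= #|B|.
Proof.
move=> iI sIX /maxsetP[/andP[iB sBX] maxB]; rewrite leqNgt; apply/negP => ltBI.
have [x /setDP[xI xB] ixB] := indep_aug iB iI ltBI.
have /setP/(_ x) : x |: B = B.
  apply: maxB; last exact: subsetUr.
  by rewrite ixB subUset sub1set sBX (subsetP sIX).
by rewrite setU11 (negbTE xB).
Qed.

Lemma basis_in_card M X B B' : basis_in M X B -> basis_in M X B' -> #|B| = #|B'|.
Proof.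
move=> bB bB'; apply/eqP; rewrite eqn_leq.
have /andP[iB sB] := maxsetp bB; have /andP[iB' sB'] := maxsetp bB'.
by rewrite (basis_in_card_le iB sB bB') (basis_in_card_le iB' sB' bB).
Qed.

Definition delete_ground M D : {set T} := ground M :\: D.

Definition delete_indep M D : {set {set T}} :=
  [set I in indep M | I \subset delete_ground M D].

Program Definition delete M D : matroid T :=
  @Matroid T (delete_ground M D) (delete_indep M D) _ _ _ _.
Next Obligation. by move=> M D I; rewrite inE => /andP[]. Qed.
Next Obligation. by move=> M D; rewrite inE indep_set0 sub0set. Qed.
Next Obligation.
move=> M D I J sIJ; rewrite !inE => /andP[iJ sJ].
by rewrite (indep_sub sIJ iJ) (subset_trans sIJ sJ).
Qed.
Next Obligation.
move=> M D I J; rewrite !inE => /andP[iI sI] /andP[iJ sJ] ltIJ.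
have [x xJI ixI] := indep_aug iI iJ ltIJ; exists x => //.
rewrite inE ixI subUset sub1set sI andbT (subsetP sJ) //.
by case/setDP: xJI.
Qed.

Definition contract_ground M C : {set T} := ground M :\: C.

Definition contract_indep M C : {set {set T}} :=
  [set I : {set T} | (I \subset contract_ground M C) &&
    [exists B : {set T}, basis_in M C B && (I :|: B \in indep M)]].

Program Definition contract M C : matroid T :=
  @Matroid T (contract_ground M C) (contract_indep M C) _ _ _ _.
Next Obligation. by move=> M C I; rewrite inE => /andP[]. Qed.
Next Obligation.
move=> M C; rewrite inE sub0set /=.
have [|B bB _] := @maxset_exists T (fun I => (I \in indep M) && (I \subset C)) set0.
  by rewrite indep_set0 sub0set.
apply/existsP; exists B; rewrite /basis_in bB set0U.
by have /andP[] := maxsetp bB.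
Qed.
Next Obligation.
move=> M C I J sIJ; rewrite !inE => /andP[sJ /existsP[B /andP[bB iJB]]].
rewrite (subset_trans sIJ sJ); apply/existsP; exists B; rewrite bB.
exact: indep_sub (setSU _ sIJ) iJB.
Qed.
Next Obligation.
move=> M C I J; rewrite !inE => /andP[sI /existsP[B /andP[bB iIB]]].
move=> /andP[sJ /existsP[B' /andP[bB' iJB']]] ltIJ.
have disj (K L : {set T}) : K \subset contract_ground M C -> basis_in M C L ->
    #|K :|: L| = #|K| + #|L|.
  move=> sK /maxsetp/andP[_ sL]; rewrite cardsU; have -> : K :&: L = set0.
    apply/setP => x; rewrite !inE; apply/negP => /andP[/(subsetP sK)].
    by rewrite inE => /andP[/negP xC _] /(subsetP sL).
  by rewrite cards0 subn0.
have lt : #|I :|: B| < #|J :|: B'|.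
  by rewrite !disj // (basis_in_card bB bB') ltn_add2r.
have [x] := indep_aug iIB iJB' lt.
rewrite !inE negb_or => /andP[/andP[xI xB] xJB'] ixIB.
have xJ : x \in J.
  case/orP: xJB' => // xB'; have /maxsetP[/andP[iB sB] maxB] := bB.
  have /andP[_ sB'] := maxsetp bB'.
  have /setP/(_ x) : x |: B = B.
    apply: maxB; last exact: subsetUr.
    rewrite subUset sub1set sB (subsetP sB') // !andbT.
    by apply: (indep_sub _ ixIB); rewrite setUS ?subsetUr.
  by rewrite setU11 (negbTE xB).
exists x; first by rewrite inE xI xJ.
rewrite inE subUset sub1set (subsetP sJ) // sI; apply/existsP; exists B.
by rewrite bB -setUA.
Qed.

Definition proper_minor N M : Prop :=
  exists C D, [/\ C \subset ground M, D \subset ground M, [disjoint C & D],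
                  C :|: D != set0 & N = delete (contract M C) D].

Definition excluded_minor (P : matroid T -> Prop) M : Prop :=
  ~ P M /\ forall N, proper_minor N M -> P N.

(* [free] is applied to the family of columns indexed by X: a repeated column *)
(* makes it dependent.                                                        *)
Definition representable (F : fieldType) M : Prop :=
  exists (n : nat) (v : T -> 'cV[F]_n),
    forall X, X \subset ground M -> (X \in indep M) = free [seq v x | x in X].

End Matroids.

Section Trees.
Variables (V : finType) (e : rel V).

Definition is_tree : Prop :=
  [/\ symmetric e, irreflexive e, 0 < #|V|,
      (forall x y, connect e x y)
    & (forall c : seq V, 2 < size c -> ~ ucycle e c)].

Definition degree (x : V) : nat := #|[set y | e x y]|.

Definition leaves : {set V} := [set x | degree x == 1].

Definition is_cubic_tree : Prop :=
  is_tree /\ forall x, x \notin leaves -> degree x = 3.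

Definition remove_edge (x y : V) : rel V :=
  [rel u v | e u v && ([set u; v] != [set x; y])].

Definition edge_component (x y : V) : {set V} :=
  [set z | connect (remove_edge x y) x z].

End Trees.

(* The values of [bd_label] at the internal vertices are irrelevant. *)
Record branch_decomposition (T : finType) (M : matroid T) := BranchDecomposition {
  bd_vertex : finType;
  bd_edge : rel bd_vertex;
  bd_label : bd_vertex -> T;
  bd_cubic : is_cubic_tree bd_edge;
  bd_label_inj : {in leaves bd_edge &, injective bd_label};
  bd_label_onto : bd_label @: leaves bd_edge = ground M
}.

Section BranchWidth.
Variables (T : finType) (M : matroid T).

Definition edge_width (d : branch_decomposition M) (x y : bd_vertex d) : nat :=
  let e := @bd_edge T M d in
  (connectivity M (@bd_label T M d @: (leaves e :&: edge_component e x y))).+1.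

(* Each edge is visited in both orientations, hence with both of its sides;   *)
(* they give the same width.                                                  *)
Definition width (d : branch_decomposition M) : nat :=
  \max_(p : bd_vertex d * bd_vertex d | bd_edge p.1 p.2) edge_width p.1 p.2.

Definition has_branch_width (k : nat) : Prop :=
  if #|ground M| <= 1 then k = #|ground M|
  else (exists d : branch_decomposition M, width d = k) /\
       (forall d : branch_decomposition M, k <= width d).

End BranchWidth.

Fixpoint tower (s : seq nat) : nat :=
  if s is a :: s' then a ^ tower s' else 1.

(* Main.v *)
Require Import Defs.
From HB Require Import structures.
From mathcomp Require Import all_boot all_order all_algebra.
From mathcomp Require Import zify.

Set Implicit Arguments.
Unset Strict Implicit.
Unset Printing Implicit Defensive.

Import VectorInternalTheory.

(** The excluded minor [M] is not representable, but everything obtained from it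
    by deletions and contractions is. Suppose that [M] has many nested separations
    [A 0, A 1, ..., A n] of the same order [t], such that no separation between
    two consecutive ones has smaller order. By Tutte's linking theorem
    ([linking], a consequence of matroid intersection) one can contract sets
    [link j l], skew to both sides, that carry the interface between [A j] and its
    complement [B j] onto the one between [A l] and [B l]. Contracting a single
    linking set gives for every [l] a proper minor on [A l] and [B l.+1], which is
    representable, and in which the spans of the two sides meet in a space of
    dimension [t].

    If [j < l], one may try to represent [M] by gluing the left part of the
    representation attached to [l] with the right part of the one attached to [j].
    The local connectivities of all pairs of sets on the two sides must then come
    out right. For this it is enough that every set [Y] on the right of [j] has a
    partner [Y'] on the right of [l] that occupies the same subspace of [F^t], and
    that [Y] and [Y'] with the linking set have, in [M], the same local
    connectivity with every set on the left ([glue_alike]). The latter condition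
    refers to all the subsets of a large set, and it has to be expressed by a
    bounded amount of information although [M] has no representation. One fixes an
    element [f] at the left end: representations of [M \ f] and of [M / f] describe
    the sets that avoid [f] and those that contain it, and in either of them only
    the trace of [Y] on the interface matters, a subspace of dimension at most [t]
    ([conn_eq_of_labels]). So the type of an interface is a set of triples of
    subspaces of [F^t], up to a few bits; there are at most about
    [2 ^ (2 * q ^ (3 * t ^ 2))] types, and two equal types among the [n] interfaces
    would represent [M] ([linked_chain_bound]).

    A chain of separations of order at most [K] need not be linked. Cutting it at
    the sets of least order, submodularity shows that a long chain of separations
    of bounded order forces a long linked chain ([bounded_order_chain]), the length
    being raised to the power of the number of possible orders. Finally, a cubic
    tree with more than [2 ^ d.+1] leaves has a path along which the separations
    displayed by the edges form a chain of [d.+1] sets ([branch_width_chain]). Thus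
    the size of [M] is at most triply exponential in [k]. The estimates of
    [tower_bound] need [1 < k]; for [k = 1] all displayed separations have order 0,
    while [M], being an excluded minor, is connected
    ([excluded_minor_connected]). *)

(** * Rank function of a matroid *)

Section Rank.
Variables (T : finType) (M : matroid T).
Implicit Types (A B C D I J X Y Z : {set T}).
Local Notation r := (rank M).

Lemma card_le_rank I X : I \in indep M -> I \subset X -> #|I| <= r X.
Proof.
move=> iI sIX; rewrite /rank (bigD1 I) /=; first exact: leq_maxl.
by rewrite iI.
Qed.

Lemma basis_in_indep X B : basis_in M X B -> B \in indep M.
Proof. by case/maxsetp/andP. Qed.

Lemma basis_in_sub X B : basis_in M X B -> B \subset X.
Proof. by case/maxsetp/andP. Qed.

Lemma rank_basis X B : basis_in M X B -> r X = #|B|.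
Proof.
move=> bB; apply/eqP; rewrite eqn_leq card_le_rank ?(basis_in_indep bB) //;
  last exact: basis_in_sub bB.
rewrite andbT; apply/bigmax_leqP => I /andP[iI sI].
exact: basis_in_card_le bB.
Qed.

Lemma extend_basis I X : I \in indep M -> I \subset X ->
  exists2 B, basis_in M X B & I \subset B.
Proof.
move=> iI sI; have [|B bB sIB] :=
  @maxset_exists T (fun I => (I \in indep M) && (I \subset X)) I.
  by rewrite iI.
by exists B.
Qed.

Lemma basis_exists X : exists B, basis_in M X B.
Proof.
by have [B bB _] := extend_basis (indep_set0 M) (sub0set X); exists B.
Qed.

Lemma rank_set0 : r set0 = 0.
Proof.
have [B bB] := basis_exists set0; rewrite (rank_basis bB).
by have := basis_in_sub bB; rewrite subset0 => /eqP->; rewrite cards0.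
Qed.

Lemma rankS X Y : X \subset Y -> r X <= r Y.
Proof.
move=> sXY; apply/bigmax_leqP => I /andP[iI sI].
exact: card_le_rank (subset_trans sI sXY).
Qed.

Lemma rank_le_card X : r X <= #|X|.
Proof. by apply/bigmax_leqP => I /andP[_ sI]; apply: subset_leq_card. Qed.

Lemma indep_rank I : (I \in indep M) = (r I == #|I|).
Proof.
apply/idP/eqP => [iI | rI].
  by apply/eqP; rewrite eqn_leq rank_le_card card_le_rank.
have [B bB] := basis_exists I.
suff <- : B = I by exact: basis_in_indep bB.
by apply/eqP; rewrite eqEcard (basis_in_sub bB) -rI (rank_basis bB) leqnn.
Qed.

(** A basis of the intersection extends to a basis of the union; its traces on
    the two sets are independent and overlap in the basis one started from. *)
Lemma rank_submod X Y : r (X :|: Y) + r (X :&: Y) <= r X + r Y.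
Proof.
have [B0 bB0] := basis_exists (X :&: Y).
have sB0 := basis_in_sub bB0.
have [|B bB sB] := @extend_basis B0 (X :|: Y) (basis_in_indep bB0).
  by apply: subset_trans sB0 _; apply: subset_trans (subsetIl _ _) (subsetUl _ _).
have iB := basis_in_indep bB.
have leX : #|B :&: X| <= r X.
  by apply: card_le_rank; [exact: indep_sub (subsetIl _ _) iB | exact: subsetIr].
have leY : #|B :&: Y| <= r Y.
  by apply: card_le_rank; [exact: indep_sub (subsetIl _ _) iB | exact: subsetIr].
rewrite (rank_basis bB) (rank_basis bB0).
have eqB : B = (B :&: X) :|: (B :&: Y).
  by rewrite -setIUr; apply/esym/setIidPl/(basis_in_sub bB).
have := cardsUI (B :&: X) (B :&: Y); rewrite -eqB => eqc.
have : #|B0| <= #|(B :&: X) :&: (B :&: Y)|.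
  apply: subset_leq_card; apply/subsetP => x xB0; rewrite !inE (subsetP sB) //=.
  by have := subsetP sB0 x xB0; rewrite inE.
lia.
Qed.

Lemma rank_subadd X Y : r (X :|: Y) <= r X + r Y.
Proof. by have := rank_submod X Y; lia. Qed.

(** Diminishing returns, written without subtraction. *)
Lemma rank_margin X Y Z : X \subset Y -> r (Y :|: Z) + r X <= r Y + r (X :|: Z).
Proof.
move=> sXY; have := rank_submod Y (X :|: Z).
have -> : Y :|: (X :|: Z) = Y :|: Z by rewrite setUA (setUidPl sXY).
have : r X <= r (Y :&: (X :|: Z)) by apply: rankS; rewrite subsetI sXY subsetUl.
lia.
Qed.

(** ** Local connectivity *)

Definition conn X Y := r X + r Y - r (X :|: Y).

Lemma connE X Y : conn X Y + r (X :|: Y) = r X + r Y.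
Proof. by have := rank_subadd X Y; rewrite /conn; lia. Qed.

Lemma connC X Y : conn X Y = conn Y X.
Proof. by rewrite /conn addnC setUC. Qed.

Lemma connSr X Y Z : Y \subset Z -> conn X Y <= conn X Z.
Proof.
move=> sYZ; have := @rank_margin Y Z X sYZ.
rewrite (setUC Z) (setUC Y); have := connE X Y; have := connE X Z; lia.
Qed.

Lemma connSl X Y Z : X \subset Y -> conn X Z <= conn Y Z.
Proof. by rewrite !(connC _ Z); apply: connSr. Qed.

(** That is, [C] is independent and skew to [X]: contracting [C] changes no rank
    within [X]. *)
Definition skewed X C := r (X :|: C) == r X + #|C|.

Lemma skew_sub X Y C : X \subset Y -> skewed Y C -> skewed X C.
Proof.
move=> sXY /eqP eqY; have := rank_margin C sXY; rewrite eqY => h.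
rewrite /skewed eqn_leq; have := rank_subadd X C; have := rank_le_card C; lia.
Qed.

Lemma skew_rank X C : skewed X C -> r C = #|C|.
Proof.
by move/(skew_sub (sub0set X)); rewrite /skewed set0U rank_set0 => /eqP.
Qed.

Lemma skewU X C C' : [disjoint C & C'] -> skewed X C -> skewed (X :|: C) C' ->
  skewed X (C :|: C').
Proof.
rewrite /skewed => dCC' /eqP e1 /eqP e2.
by rewrite setUA e2 e1 cardsU (disjoint_setI0 dCC') cards0 subn0 addnA.
Qed.

(** Both sides are the local connectivity of [X] and [Y] after contraction of [C],
    which adds [#|C|] to the rank of either. *)
Lemma conn_shift X Y C : skewed X C -> skewed Y C -> conn (X :|: C) Y = conn X (Y :|: C).
Proof.
move=> /eqP e1 /eqP e2; rewrite /conn e1 e2.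
by rewrite (setUAC X C Y) -(setUA X Y C); congr (_ - _); rewrite addnAC addnA.
Qed.

Lemma connectivityE X : X \subset ground M ->
  connectivity M X = conn X (ground M :\: X).
Proof.
move=> sX; rewrite /connectivity /conn; congr (_ - r _).
by rewrite -{1}(setID (ground M) X) (setIidPr sX).
Qed.

(** Submodularity of the rank is used for the two sets and for their complements;
    for subsets of the ground set no subtraction is truncated. *)
Lemma connectivity_submod X Y : X \subset ground M -> Y \subset ground M ->
  connectivity M (X :|: Y) + connectivity M (X :&: Y)
    <= connectivity M X + connectivity M Y.
Proof.
move=> sX sY; rewrite /connectivity setDUr setDIr.
have h1 := rank_submod X Y.
have h2 := rank_submod (ground M :\: X) (ground M :\: Y).
have le Z : Z \subset ground M -> r (ground M) <= r Z + r (ground M :\: Z).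
  move=> sZ; have := rank_subadd Z (ground M :\: Z).
  by rewrite setDE setUIr setUCr setIT (setUidPr sZ).
have := le _ sX; have := le _ sY.
have := le (X :|: Y); rewrite subUset sX sY setDUr => /(_ isT).
have := le (X :&: Y); rewrite setDIr => /(_ (subset_trans (subsetIl _ _) sX)).
lia.
Qed.

End Rank.

(** ** Ranks in minors *)

Section MinorRank.
Variables (T : finType) (M : matroid T).
Implicit Types (C D X : {set T}).

Lemma rank_delete D X : X \subset ground M :\: D -> rank (delete M D) X = rank M X.
Proof.
move=> sX; apply: eq_bigl => I; rewrite inE -andbA.
case: (I \in indep M) => //=; apply/andP/idP => [[] // | sI].
by split=> //; apply: subset_trans sI sX.
Qed.

Lemma rank_contract C X : X \subset ground M :\: C ->
  rank (contract M C) X + rank M C = rank M (X :|: C).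
Proof.
move=> sX; have dXC : [disjoint X & C].
  by apply: disjointWl sX _; rewrite disjoints_subset setDE subsetIr.
have cardU (I B : {set T}) : I \subset X -> B \subset C -> #|I :|: B| = #|I| + #|B|.
  move=> sI sB; rewrite cardsU (disjoint_setI0 _) ?cards0 ?subn0 //.
  exact: disjointWl sI (disjointWr sB dXC).
apply/eqP; rewrite eqn_leq; apply/andP; split.
  have [I bI] := basis_exists (contract M C) X.
  rewrite (rank_basis bI); have sI := basis_in_sub bI.
  have := basis_in_indep bI; rewrite inE => /andP[_ /existsP[B /andP[bB iIB]]].
  rewrite (rank_basis bB) -cardU // ?(basis_in_sub bB) //.
  by apply: card_le_rank => //; apply: setUSS => //; apply: basis_in_sub bB.
have [B bB] := basis_exists M C.
have sBC := basis_in_sub bB.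
have [|J bJ sBJ] := @extend_basis _ M B (X :|: C) (basis_in_indep bB).
  exact: subset_trans sBC (subsetUr _ _).
have iJ := basis_in_indep bJ.
have JC : J :&: C = B.
  case/maxsetP: bB => _; apply; last by rewrite subsetI sBJ.
  by rewrite subsetIr (indep_sub (subsetIl _ _) iJ).
have eqJ : J = (J :&: X) :|: B.
  by rewrite -JC -setIUr; apply/esym/setIidPl/(basis_in_sub bJ).
rewrite (rank_basis bJ) (rank_basis bB) {1}eqJ cardU ?subsetIr // leq_add2r.
apply: card_le_rank (subsetIr _ _); rewrite inE.
rewrite (subset_trans (subsetIr _ _) sX); apply/existsP; exists B.
by rewrite bB -eqJ.
Qed.

End MinorRank.

Lemma rank_minor (T : finType) (M : matroid T) (C D X : {set T}) :
  X \subset ground M :\: C :\: D ->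
  rank (delete (contract M C) D) X + rank M C = rank M (X :|: C).
Proof.
move=> sX; rewrite rank_delete // rank_contract //.
exact: subset_trans sX (subsetDl _ _).
Qed.

(** * Linking *)

Section Linking.
Variables (T : finType) (M : matroid T).
Implicit Types (A B C I J K X Y Z : {set T}).
Local Notation r := (rank M).
Local Notation E := (ground M).

Lemma rank_absorb A Z : {in Z, forall z, r (z |: A) <= r A} -> r (A :|: Z) = r A.
Proof.
have [n] := ubnP #|Z|; elim: n Z => // n IHn Z leZn absZ.
have [-> | [z zZ]] := set_0Vmem Z; first by rewrite setU0.
have eqZ : r (A :|: (Z :\ z)) = r A.
  apply: IHn => [|y /setD1P[_ yZ]]; last exact: absZ.
  by rewrite (cardsD1 z) zZ in leZn.
have := rank_margin M [set z] (subsetUl A (Z :\ z)); rewrite eqZ.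
have -> : A :|: Z :\ z :|: [set z] = A :|: Z by rewrite -setUA (setUC _ [set z]) setD1K.
have := rankS M (subsetUl A Z); have := absZ z zZ; rewrite setUC; lia.
Qed.

(** Matroid intersection for the contractions [M / A] and [M / B] restricted to
    [Z]. An element [e] that is a loop of neither can be deleted or contracted,
    unless both operations lower the minimum; but then uncrossing the two
    witnesses contradicts the hypothesis. *)
Lemma common_skew_set Z A B k :
    (forall Z1, Z1 \subset Z -> k + r A + r B <= r (A :|: Z1) + r (B :|: (Z :\: Z1))) ->
  exists I, [/\ I \subset Z, k <= #|I|, skewed M A I & skewed M B I].
Proof.
have skew0 X : skewed M X set0 by rewrite /skewed setU0 cards0 addn0.
have [n] := ubnP #|Z|; elim: n Z A B k => // n IHn Z A B [|k] leZn minZ.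
  by exists set0; rewrite sub0set.
pose free_el e := [&& e \in Z, r (e |: A) == (r A).+1 & r (e |: B) == (r B).+1].
have add1 e X : r (e |: X) <= (r X).+1.
  by have := rank_subadd M [set e] X; have := rank_le_card M [set e]; rewrite cards1; lia.
have [e /and3P[eZ /eqP eA /eqP eB] | nofree] := pickP free_el; last first.
  pose Z1 := [set z in Z | r (z |: A) <= r A].
  have rA : r (A :|: Z1) = r A by apply: rank_absorb => z; rewrite inE => /andP[].
  have rB : r (B :|: (Z :\: Z1)) = r B.
    apply: rank_absorb => z /setDP[zZ]; rewrite inE zZ /= -ltnNge => ltA.
    have := nofree z; rewrite /free_el zZ /=; have := add1 z A; have := add1 z B.
    lia.
  have sZ1 : Z1 \subset Z by apply/subsetP => z; rewrite inE => /andP[].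
  by have := minZ Z1 sZ1; rewrite rA rB; lia.
have ltZ : #|Z :\ e| < n by rewrite (cardsD1 e) eZ in leZn.
have [/forallP minD | ] := boolP [forall Z1 : {set T}, (Z1 \subset Z :\ e) ==>
    (k.+1 + r A + r B <= r (A :|: Z1) + r (B :|: ((Z :\ e) :\: Z1)))].
  have [|I [sI leI sA sB]] := IHn (Z :\ e) A B k.+1 ltZ.
    by move=> Z1 sZ1; have := minD Z1; rewrite sZ1.
  by exists I; split=> //; apply: subset_trans sI (subD1set _ _).
rewrite negb_forall => /existsP[J]; rewrite negb_imply -ltnNge => /andP[sJ ltJ].
have [/forallP minC | ] := boolP [forall Z1 : {set T}, (Z1 \subset Z :\ e) ==>
    (k + r (e |: A) + r (e |: B)
       <= r (e |: A :|: Z1) + r (e |: B :|: ((Z :\ e) :\: Z1)))].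
  have [|I [sI leI sA sB]] := IHn (Z :\ e) (e |: A) (e |: B) k ltZ.
    by move=> Z1 sZ1; have := minC Z1; rewrite sZ1.
  have eI : e \notin I by apply/negP => /(subsetP sI); rewrite !inE eqxx.
  have skewE X : r (e |: X) = (r X).+1 -> skewed M (e |: X) I -> skewed M X (e |: I).
    move=> eX; rewrite setUC => sX; apply: skewU sX; first by rewrite disjoints1.
    by rewrite /skewed cards1 setUC eX addn1.
  exists (e |: I); split; [| by rewrite cardsU1 eI | exact: skewE | exact: skewE].
  by rewrite subUset sub1set eZ (subset_trans sI (subD1set _ _)).
rewrite negb_forall => /existsP[K]; rewrite negb_imply -ltnNge => /andP[sK].
rewrite eA eB => ltK.
have sJZ := subset_trans sJ (subD1set Z e); have sKZ := subset_trans sK (subD1set Z e).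
have := minZ (e |: (J :|: K)); rewrite !subUset sub1set eZ sJZ sKZ => /(_ isT).
have := minZ (J :&: K); rewrite (subset_trans (subsetIl _ _) sJZ) => /(_ isT).
have := rank_submod M (A :|: J) (e |: A :|: K).
have := rank_submod M (B :|: ((Z :\ e) :\: J)) (e |: B :|: ((Z :\ e) :\: K)).
have -> : A :|: J :|: (e |: A :|: K) = A :|: (e |: (J :|: K)).
  by apply/setP => x; rewrite !inE; do ![case: (_ \in _) | case: (_ == _)].
have -> : B :|: (Z :\ e) :\: J :|: (e |: B :|: (Z :\ e) :\: K) = B :|: (Z :\: (J :&: K)).
  apply/setP => x; rewrite !inE; have [-> | _] := eqVneq x e.
    have /negbTE-> : e \notin J by apply/negP => /(subsetP sJ); rewrite !inE eqxx.
    by rewrite eZ /= !orbT.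
  by do ![case: (_ \in _)].
have : r (A :|: (J :&: K)) <= r ((A :|: J) :&: (e |: A :|: K)).
  by apply: rankS; apply/subsetP => x; rewrite !inE; do ![case: (_ \in _)]; rewrite ?orbT.
have : r (B :|: Z :\: (e |: (J :|: K)))
    <= r ((B :|: (Z :\ e) :\: J) :&: (e |: B :|: (Z :\ e) :\: K)).
  apply: rankS; apply/subsetP => x; rewrite !inE.
  by do ![case: (_ \in _) | case: (_ == _)].
lia.
Qed.

(** Tutte's linking theorem. The set [C] is provided by [common_skew_set] for the
    two sides [A] and [E :\: A']: there, up to a constant, the minimum is the
    least order of a separation between [A] and [A']. *)
Lemma linking A A' t : A \subset A' -> A' \subset E ->
    connectivity M A = t -> connectivity M A' = t ->
    (forall X, A \subset X -> X \subset A' -> t <= connectivity M X) ->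
  exists C, [/\ C \subset A' :\: A, skewed M A C, skewed M (E :\: A') C
                & conn M (A :|: C) (E :\: A') = t].
Proof.
move=> sAA' sA'E lA lA' lmin; pose B := E :\: A'.
have sAE := subset_trans sAA' sA'E.
have eA := connE M A (E :\: A); rewrite -connectivityE // lA in eA.
have eA' := connE M A' B; rewrite -connectivityE // lA' in eA'.
have UD X : X \subset E -> X :|: (E :\: X) = E.
  by move=> sX; rewrite -{1}(setIidPr sX) setID.
rewrite UD // in eA; rewrite UD // in eA'.
have leA : r A <= r A' by apply: rankS.
have [Z1 sZ1|I [sI leI sA sB]] := @common_skew_set (A' :\: A) A B (t + r E - r A - r B).
  have sX : A :|: Z1 \subset A'.
    by rewrite subUset sAA' (subset_trans sZ1 (subsetDl _ _)).
  have := lmin _ (subsetUl A Z1) sX; have := connE M (A :|: Z1) (E :\: (A :|: Z1)).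
  rewrite -connectivityE ?UD ?(subset_trans sX) //.
  have -> : B :|: (A' :\: A) :\: Z1 = E :\: (A :|: Z1); last by lia.
  apply/setP => x; rewrite !inE; have := subsetP sA'E x; have := subsetP sX x.
  rewrite !inE; case: (x \in A) (x \in Z1) (x \in A') (x \in E) => [] [] [] [] //=;
    by [move=> /(_ isT) | move=> _ /(_ isT)].
exists I; split=> //; have sIA' : A :|: I \subset A'.
  by rewrite subUset sAA' (subset_trans sI (subsetDl _ _)).
apply/eqP; rewrite eqn_leq; apply/andP; split.
  by rewrite -lA' (connectivityE sA'E); apply: connSl.
rewrite -/B; have := connE M (A :|: I) B; rewrite (eqP sA).
have : r (A :|: I :|: B) <= r E by apply: rankS; rewrite subUset (subset_trans sIA') ?subsetDl.
lia.
Qed.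

End Linking.

(** * Representations and their amalgamation *)

Section SpanOf.
Variables (F : fieldType) (T : finType).
Implicit Types (X Y : {set T}).

Definition span_of (vT : vectType F) (v : T -> vT) X := (\sum_(x in X) <[v x]>)%VS.

Lemma memv_span_of (vT : vectType F) (v : T -> vT) X x : x \in X -> v x \in span_of v X.
Proof. by move=> xX; rewrite memvE /span_of (sumv_sup x). Qed.

Lemma span_of_subP (vT : vectType F) (v : T -> vT) X (U : {vspace vT}) :
  reflect {in X, forall x, v x \in U} (span_of v X <= U)%VS.
Proof. by apply: (iffP subv_sumP) => h x /h; rewrite -?memvE. Qed.

Lemma span_ofS (vT : vectType F) (v : T -> vT) X Y :
  X \subset Y -> (span_of v X <= span_of v Y)%VS.
Proof. by move=> sXY; apply/span_of_subP => x /(subsetP sXY)/memv_span_of. Qed.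

Lemma span_ofU (vT : vectType F) (v : T -> vT) X Y :
  span_of v (X :|: Y) = (span_of v X + span_of v Y)%VS.
Proof.
apply/eqP; rewrite eqEsubv subv_add !span_ofS ?subsetUl ?subsetUr // !andbT.
apply/span_of_subP => x /setUP[] xX; first exact: subvP (addvSl _ _) _ (memv_span_of _ xX).
exact: subvP (addvSr _ _) _ (memv_span_of _ xX).
Qed.

Lemma span_of_image (vT : vectType F) (v : T -> vT) X :
  (<<[seq v x | x in X]>>)%VS = span_of v X.
Proof. by rewrite span_def big_image. Qed.

Lemma limg_span_of (vT wT : vectType F) (f : 'Hom(vT, wT)) (v : T -> vT) X :
  (f @: span_of v X)%VS = span_of (f \o v) X.
Proof. by rewrite /span_of limg_sum; apply: eq_bigr => x _; rewrite limg_line. Qed.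

Lemma eq_span_of (vT : vectType F) (v w : T -> vT) X :
  {in X, v =1 w} -> span_of v X = span_of w X.
Proof. by move=> eqv; apply: eq_bigr => x /eqv->. Qed.

Lemma free_span_of (vT : vectType F) (v : T -> vT) X :
  free [seq v x | x in X] = (\dim (span_of v X) == #|X|).
Proof. by rewrite /free span_of_image size_map -cardE. Qed.

Lemma dim_cap_span_of (vT : vectType F) (v : T -> vT) X Y :
  \dim (span_of v X :&: span_of v Y)%VS + \dim (span_of v (X :|: Y))
    = \dim (span_of v X) + \dim (span_of v Y).
Proof. by rewrite span_ofU addnC dimv_sum_cap. Qed.

(** Ranks pass to minors more directly than independent sets do, and values in
    an arbitrary vector space allow one to form sums and quotients. *)
Definition represents (vT : vectType F) (v : T -> vT) (M : matroid T) :=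
  forall X, X \subset ground M -> \dim (span_of v X) = rank M X.

(** A basis of [X] has independent values, and these span the values on [X], for
    otherwise the basis could be enlarged. *)
Lemma representable_rank (M : matroid T) : representable F M ->
  exists n (v : T -> 'cV[F]_n), represents v M.
Proof.
case=> n [v repv]; exists n, v => X sX.
have [B bB] := basis_exists M X; rewrite (rank_basis bB).
have sB := basis_in_sub bB; have sBE := subset_trans sB sX.
have dimB : \dim (span_of v B) = #|B|.
  by apply/eqP; rewrite -free_span_of -repv // (basis_in_indep bB).
suff -> : span_of v X = span_of v B by [].
apply/eqP; rewrite eqEsubv (span_ofS v sB) andbT; apply/span_of_subP => x xX.
have [xB | xB] := boolP (x \in B); first exact: memv_span_of.
have sxX : x |: B \subset X by rewrite subUset sub1set xX.
apply/negPn/negP => vx; case/maxsetP: (bB) => _ maxB.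
have eqB : x |: B = B -> False by move=> eqB; rewrite -eqB setU11 in xB.
apply: eqB; apply: maxB (subsetUr _ _); apply/andP; split=> //.
rewrite repv ?(subset_trans sxX) // free_span_of cardsU1 xB.
rewrite span_ofU /span_of big_set1 -/(span_of v B) dimv_disjoint_sum ?dimB ?dim_vline.
  suff -> : v x != 0%R by [].
  by apply: contraNneq vx => vx0; rewrite vx0 mem0v.
apply/eqP; rewrite -subv0; apply/subvP => u; rewrite memv_cap => /andP[/vlineP[k ->]].
have [-> | k0] := eqVneq k 0%R; first by rewrite GRing.scale0r !mem0v.
move/(memvZ k^-1%R); rewrite GRing.scalerA GRing.mulVf // GRing.scale1r => vx'.
by rewrite vx' in vx.
Qed.

Lemma represents_representable (vT : vectType F) (v : T -> vT) (M : matroid T) :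
  represents v M -> representable F M.
Proof.
move=> repv; pose f : 'Hom(vT, 'cV[F]_(dim vT)) := linfun (trmx \o @v2r F vT).
have f_inj : lker f == 0%VS.
  apply/lker0P => x y; rewrite /f !lfunE /= => /trmx_inj.
  exact: v2r_inj.
exists (dim vT), (f \o v) => X sX.
rewrite free_span_of -limg_span_of limg_dim_eq ?(eqP f_inj) ?capv0 //.
by rewrite repv // indep_rank.
Qed.

End SpanOf.

Section Amalgam.
Variable F : fieldType.

Lemma exists_quotient (vT : vectType F) (R : {vspace vT}) :
  exists q : 'End(vT), lker q = R.
Proof.
exists (\1%VF - projv R)%R; apply/vspaceP => u.
rewrite memv_ker add_lfunE opp_lfunE id_lfunE GRing.subr_eq0.
apply/eqP/idP => [-> | uR]; first exact: memv_proj.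
by rewrite projv_id.
Qed.

Section Pairs.
Variables U1 U2 : vectType F.

Definition pair_l (u : U1) : (U1 * U2)%type := (u, 0%R).
Definition pair_r (u : U2) : (U1 * U2)%type := (0%R, u).

Fact pair_l_linear : linear pair_l.
Proof. by move=> k u v; congr (_, _); rewrite /= GRing.scaler0 GRing.addr0. Qed.

Fact pair_r_linear : linear pair_r.
Proof. by move=> k u v; congr (_, _); rewrite /= GRing.scaler0 GRing.addr0. Qed.

HB.instance Definition _ :=
  GRing.isLinear.Build F U1 (U1 * U2)%type _ pair_l pair_l_linear.
HB.instance Definition _ :=
  GRing.isLinear.Build F U2 (U1 * U2)%type _ pair_r pair_r_linear.

Lemma memv_pairs (X : {vspace U1}) (Y : {vspace U2}) u :
  (u \in (linfun pair_l @: X + linfun pair_r @: Y)%VS) = (u.1 \in X) && (u.2 \in Y).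
Proof.
apply/memv_addP/andP => [[_ /memv_imgP[x xX ->] [_ /memv_imgP[y yY ->] ->]] | [uX uY]].
  by rewrite !lfunE /= GRing.addr0 GRing.add0r.
exists (linfun pair_l u.1); first exact: memv_img.
exists (linfun pair_r u.2); first exact: memv_img.
by rewrite !lfunE; case: u {uX uY} => a b; congr (_, _); rewrite /= ?GRing.addr0 ?GRing.add0r.
Qed.

Lemma dimv_pairs (X : {vspace U1}) (Y : {vspace U2}) :
  \dim (linfun pair_l @: X + linfun pair_r @: Y)%VS = \dim X + \dim Y.
Proof.
have inj_l : lker (linfun pair_l) == 0%VS by apply/lker0P => x y; rewrite !lfunE => -[].
have inj_r : lker (linfun pair_r) == 0%VS by apply/lker0P => x y; rewrite !lfunE => -[].
rewrite dimv_disjoint_sum ?limg_dim_eq ?(eqP inj_l) ?(eqP inj_r) ?capv0 //.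
apply/eqP; rewrite -subv0; apply/subvP => u.
rewrite memv_cap => /andP[/memv_imgP[x _ ->] /memv_imgP[y _]].
by rewrite !lfunE => -[-> _]; rewrite memv0.
Qed.

End Pairs.

(** Amalgam of [U1 / K] and [U2] along [L]: the quotient of the direct sum of
    [U1] and [U2] by [K] and by the differences of the two images of [L]. *)
Lemma amalgam (U1 U2 L : vectType F) (i1 : 'Hom(L, U1)) (i2 : 'Hom(L, U2))
    (K : {vspace U1}) : lker i2 == 0%VS ->
  exists (U : vectType F) (a1 : 'Hom(U1, U)) (a2 : 'Hom(U2, U)),
    forall (X : {vspace U1}) (Y : {vspace U2}),
      \dim (a1 @: X + a2 @: Y)%VS
        + \dim (i1 @^-1: (X + K) :&: i2 @^-1: Y)%VS + \dim K
      = \dim (X + K)%VS + \dim Y.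
Proof.
move=> i2inj.
pose j1 := linfun (@pair_l U1 U2); pose j2 := linfun (@pair_r U1 U2).
pose d : 'Hom(L, (U1 * U2)%type) := ((j1 \o i1)%VF - (j2 \o i2)%VF)%R.
have dE w : d w = (i1 w, - i2 w)%R.
  rewrite add_lfunE opp_lfunE !comp_lfunE !lfunE.
  by congr (_, _); rewrite /= ?GRing.subr0 ?GRing.sub0r.
have dinj : lker d == 0%VS.
  apply/lker0P => x y; rewrite !dE => -[_ /GRing.oppr_inj].
  by apply/lker0P.
have dim_d (X : {vspace U1}) (Y : {vspace U2}) :
    \dim (j1 @: X + j2 @: Y + limg d)%VS + \dim (i1 @^-1: X :&: i2 @^-1: Y)%VS
      = \dim X + \dim Y + dim L.
  have <- : \dim (d @: (i1 @^-1: X :&: i2 @^-1: Y)) = \dim (i1 @^-1: X :&: i2 @^-1: Y).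
    by rewrite limg_dim_eq ?(eqP dinj) ?capv0.
  have -> : (d @: (i1 @^-1: X :&: i2 @^-1: Y) = (j1 @: X + j2 @: Y) :&: limg d)%VS.
    apply/vspaceP => u; rewrite memv_cap memv_pairs.
    apply/memv_imgP/andP => [[w] | [/andP[uX uY] /memv_imgP[w _ eqw]]].
      rewrite memv_cap -!memv_preim => /andP[wX wY] ->.
      by rewrite memv_img ?memvf // dE /= memvN wX.
    exists w => //; move: uX uY; rewrite eqw dE /= memvN => uX uY.
    by rewrite memv_cap -!memv_preim uX.
  rewrite dimv_sum_cap dimv_pairs; congr (_ + _).
  by rewrite limg_dim_eq ?dimvf // (eqP dinj) capv0.
have [q kerq] := exists_quotient (j1 @: K + limg d)%VS.
exists ((U1 * U2)%type : vectType F), (q \o j1)%VF, (q \o j2)%VF => X Y.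
rewrite !limg_comp -limgD.
have := limg_ker_dim q (j1 @: X + j2 @: Y); rewrite kerq.
have := dimv_sum_cap (j1 @: X + j2 @: Y) (j1 @: K + limg d).
have := dim_d K 0%VS; have := dim_d (X + K)%VS Y.
rewrite !limgD limg0 addv0 lpreim0 (eqP i2inj) capv0 !dimv0 !(addn0 : right_id 0%R addn).
have -> : (j1 @: X + j2 @: Y + (j1 @: K + limg d)
           = j1 @: X + j1 @: K + j2 @: Y + limg d)%VS.
  by rewrite addvA -[in LHS](addvA (j1 @: X)%VS) (addvC (j2 @: Y)%VS) addvA.
by do ![move: (\dim _) => ?]; lia.
Qed.

End Amalgam.

Section Gluing.
Variables (F : fieldType) (T : finType) (M : matroid T).
Implicit Types (X Y : {set T}).

(** Representations of the two sides of a separation [(A, B)], the first one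
    being read modulo [K], are glued along the common subspace [L]; the outcome
    represents [M] as soon as the traces on [L] have the right intersections. *)
Lemma glue_representations (U1 U2 L : vectType F) (v1 : T -> U1) (v2 : T -> U2)
    (K : {vspace U1}) (i1 : 'Hom(L, U1)) (i2 : 'Hom(L, U2)) (A : {set T}) :
    lker i2 == 0%VS ->
    (forall X, X \subset A -> \dim (span_of v1 X + K)%VS = rank M X + \dim K) ->
    (forall Y, Y \subset ground M :\: A -> \dim (span_of v2 Y) = rank M Y) ->
    (forall X Y, X \subset A -> Y \subset ground M :\: A ->
      \dim (i1 @^-1: (span_of v1 X + K) :&: i2 @^-1: span_of v2 Y)%VS = conn M X Y) ->
  representable F M.
Proof.
move=> i2inj rk1 rk2 rk12; have [U [a1 [a2 dim_a]]] := amalgam i1 K i2inj.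
pose w x := if x \in A then a1 (v1 x) else a2 (v2 x).
apply: (@represents_representable F T U w M) => Z sZ.
have sA : Z :&: A \subset A by apply: subsetIr.
have sB : Z :\: A \subset ground M :\: A by apply: setSD.
rewrite -{1}(setID Z A) span_ofU.
have -> : span_of w (Z :&: A) = (a1 @: span_of v1 (Z :&: A))%VS.
  by rewrite limg_span_of; apply: eq_span_of => x /setIP[_ xA]; rewrite /w xA.
have -> : span_of w (Z :\: A) = (a2 @: span_of v2 (Z :\: A))%VS.
  by rewrite limg_span_of; apply: eq_span_of => x /setDP[_ /negbTE xA]; rewrite /w xA.
have := dim_a (span_of v1 (Z :&: A)) (span_of v2 (Z :\: A)).
rewrite rk1 // rk2 // rk12 //; have := connE M (Z :&: A) (Z :\: A); rewrite setID.
lia.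
Qed.

End Gluing.

(** * Traces on an interface *)

Section Traces.
Variables (F : fieldType) (T : finType).
Implicit Types (X Y Z C : {set T}).

(** In a vector space in which [C] is skew to [B], and in which the interface
    between [A] and [B] lies in the span of [A0] and [C], the traces on [A] of
    subsets of [B] can be read off after projecting from [C] onto [A0]. *)
Lemma trace_eq (vT : vectType F) (v : T -> vT) (A0 A B C Z Z' : {set T}) :
    A0 :|: C \subset A -> Z \subset B -> Z' \subset B ->
    \dim (span_of v A :&: span_of v B)
      <= \dim (span_of v (A0 :|: C) :&: span_of v B) ->
    \dim (span_of v B :&: span_of v C) = 0 ->
    (span_of v A0 :&: span_of v (Z :|: C) = span_of v A0 :&: span_of v (Z' :|: C))%VS ->
  (span_of v A :&: span_of v Z = span_of v A :&: span_of v Z')%VS.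
Proof.
move=> sA; wlog suff: Z Z' / forall sZ : Z \subset B, Z' \subset B -> 
    \dim (span_of v A :&: span_of v B)
      <= \dim (span_of v (A0 :|: C) :&: span_of v B) ->
    \dim (span_of v B :&: span_of v C) = 0 ->
    (span_of v A0 :&: span_of v (Z :|: C) = span_of v A0 :&: span_of v (Z' :|: C))%VS ->
    (span_of v A :&: span_of v Z <= span_of v A :&: span_of v Z')%VS.
  by move=> le sZ sZ' h1 h2 h3; apply/eqP; rewrite eqEsubv !le.
move=> sZ sZ' dimW dim0 eqt.
have eqW : (span_of v (A0 :|: C) :&: span_of v B = span_of v A :&: span_of v B)%VS.
  by apply/eqP; rewrite eqEdim dimW andbT capvS // span_ofS.
apply/subvP => u; rewrite memv_cap => /andP[uA uZ]; rewrite memv_cap uA /=.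
have uB : u \in span_of v B by apply: subvP (span_ofS v sZ) _ uZ.
have : u \in (span_of v (A0 :|: C) :&: span_of v B)%VS by rewrite eqW memv_cap uA.
rewrite memv_cap span_ofU => /andP[/memv_addP[a aA0 [c cC eu]] _].
have : a \in (span_of v A0 :&: span_of v (Z :|: C))%VS.
  rewrite memv_cap aA0 span_ofU; have -> : a = (u + (- c))%R by rewrite eu GRing.addrK.
  by rewrite memv_add // memvN.
rewrite eqt memv_cap span_ofU => /andP[_ /memv_addP[z zZ' [c' c'C ea]]].
suff -> : u = z by [].
have : (u - z)%R \in (span_of v B :&: span_of v C)%VS.
  rewrite memv_cap memvB //=; last exact: subvP (span_ofS v sZ') _ zZ'.
  by rewrite eu ea GRing.addrC !GRing.addrA GRing.addNr GRing.add0r memvD.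
by move/eqP: dim0; rewrite dimv_eq0 => /eqP->; rewrite memv0 GRing.subr_eq0 => /eqP.
Qed.

(** The span of [X] lies in that of [A], so that only the trace on [A] matters. *)
Lemma dim_trace_eq (vT : vectType F) (v : T -> vT) (A X Z Z' : {set T}) : X \subset A ->
    (span_of v A :&: span_of v Z = span_of v A :&: span_of v Z')%VS ->
  \dim (span_of v X :&: span_of v Z) = \dim (span_of v X :&: span_of v Z').
Proof.
move=> sX eqt; have capX : (span_of v X :&: span_of v A = span_of v X)%VS.
  by apply/capv_idPl/span_ofS.
by rewrite -capX -!capvA eqt.
Qed.

End Traces.

Section SubspaceCode.
Variable F : fieldType.

Lemma exists_lfun_onto (L vT : vectType F) (W : {vspace vT}) : \dim W <= dim L ->
  exists h : 'Hom(L, vT), limg h = W.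
Proof.
move=> leW; pose A : 'M[F]_(dim L, dim vT) :=
  (pid_mx (\rank (vs2mx W)) *m row_base (vs2mx W))%R.
exists (Hom A); rewrite /lfun_img unlock.
have eqA : (A :=: vs2mx W)%MS.
  rewrite /A; apply: (eqmx_trans _ (eq_row_base _)); apply: eqmxMfull.
  by rewrite /row_full rank_pid_mx.
apply/val_inj => /=; rewrite -[RHS]gen_vs2mx; apply/genmxP.
apply/eqmxP; apply: (eqmx_trans _ eqA).
by apply: eqmxMfull; rewrite /row_full mx2vsK mxrank1.
Qed.

(** A subspace is recovered from its preimage under a linear map from [F^t] onto
    [W]. Over a field of order [q] there are thus at most [q^(t^2)] codes, whereas
    sets of vectors would be exponentially more numerous. *)
Lemma exists_subspace_code t (vT : vectType F) (W : {vspace vT}) : \dim W <= t ->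
  exists code : {vspace vT} -> 'M[F]_(dim 'rV[F]_t),
    forall S S', (S <= W)%VS -> (S' <= W)%VS -> code S = code S' -> S = S'.
Proof.
move=> leW; have [|h hW] := @exists_lfun_onto 'rV[F]_t _ W.
  by rewrite dim_matrix -[(1 * t)%R]/(1 * t)%N mul1n.
exists (fun S => vs2mx (h @^-1: S)%VS) => S S' sS sS' /val_inj eqS.
by rewrite -(lpreimK (f := h) (W := S)) ?eqS ?lpreimK ?hW.
Qed.

End SubspaceCode.

(** * Linked chains of separations *)

(** No separation between two consecutive members has smaller order, so that the
    linking theorem identifies their interfaces. *)
Definition linked_chain (T : finType) (M : matroid T) (A : nat -> {set T}) n t : Prop :=
  [/\ forall i, i <= n -> A i \subset ground M,
      forall i, i < n -> A i \proper A i.+1,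
      forall i, i <= n -> connectivity M (A i) = t
    & forall i (X : {set T}), i < n -> A i \subset X -> X \subset A i.+1 ->
        t <= connectivity M X].

(** Think of two subspaces with the same intersection as [A] and [B], namely those
    of [P] and [B] and those of [A] and [Q]: this intersection then lies in the
    spans of [P] and of [Q]. Abstractly, it is submodularity for [P :|: B] and
    [A :|: Q]. *)
Lemma conn_meet (T : finType) (M : matroid T) (P Q A B : {set T}) t :
    P \subset A -> Q \subset B ->
    conn M A B = t -> conn M P B = t -> conn M A Q = t ->
  t <= conn M P Q.
Proof.
move=> sP sQ AB PB AQ.
have := rank_submod M (P :|: B) (A :|: Q).
have -> : P :|: B :|: (A :|: Q) = A :|: B.
  by rewrite setUACA (setUidPr sP) (setUidPl sQ).
have : rank M (P :|: Q) <= rank M ((P :|: B) :&: (A :|: Q)).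
  apply: rankS; rewrite subsetI !subUset subsetUl subsetUr.
  by rewrite (subset_trans sP (subsetUl _ _)) (subset_trans sQ (subsetUr _ _)).
have := connE M A B; have := connE M P B; have := connE M A Q; have := connE M P Q.
lia.
Qed.

Section LinkedChain.
Variables (T : finType) (M : matroid T) (A : nat -> {set T}) (n t : nat).
Hypothesis chainA : linked_chain M A n t.
Implicit Types (W X Y Z C : {set T}) (i j l : nat).
Local Notation E := (ground M).
Local Notation r := (rank M).
Let B i := E :\: A i.

Lemma chain_sub i j : i <= j -> j <= n -> A i \subset A j.
Proof.
case: chainA => _ ltA _ _ leij; elim: j leij => [|j IHj].
  by rewrite leqn0 => /eqP->.
rewrite leq_eqVlt => /predU1P[-> // | leij] ltjn.
exact: subset_trans (IHj leij (ltnW ltjn)) (proper_sub (ltA j ltjn)).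
Qed.

Lemma chain_ground i : i <= n -> A i \subset E.
Proof. by case: chainA => sA _ _ _; apply: sA. Qed.

Lemma chain_coS i j : i <= j -> j <= n -> B j \subset B i.
Proof. by move=> leij lejn; apply/setDS/chain_sub. Qed.

Lemma chain_conn i : i <= n -> conn M (A i) (B i) = t.
Proof. by case: chainA => sA _ lA _ lein; rewrite -connectivityE ?lA ?sA. Qed.

Definition link_of i : {set T} :=
  odflt set0 [pick C : {set T} | [&& C \subset A i.+1 :\: A i, skewed M (A i) C,
                  skewed M (B i.+1) C & conn M (A i :|: C) (B i.+1) == t]].

Lemma link_ofP i : i < n ->
  [/\ link_of i \subset A i.+1 :\: A i, skewed M (A i) (link_of i),
      skewed M (B i.+1) (link_of i) & conn M (A i :|: link_of i) (B i.+1) = t].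
Proof.
move=> ltin; case: chainA => sA ltA lA minA.
rewrite /link_of; case: pickP => [C /and4P[? ? ? /eqP ?] // | noC].
have [|||||C [sC skA skB cC]] := @linking _ M (A i) (A i.+1) t.
- exact: proper_sub (ltA i ltin).
- exact: sA.
- by apply: lA; apply: ltnW.
- exact: lA.
- by move=> X; apply: minA.
by have := noC C; rewrite sC skA skB cC eqxx.
Qed.

(** Contracting this set carries the interface of [A j] onto that of [A l]. The
    choice is made step by step in order that these identifications compose. *)
Definition link j l := \bigcup_(j <= i < l) link_of i.

Lemma link0 j : link j j = set0.
Proof. by rewrite /link big_geq. Qed.

Lemma link_recr j l : j <= l -> link j l.+1 = link j l :|: link_of l.
Proof. by move=> lejl; rewrite /link big_nat_recr. Qed.

Lemma link_cat i j l : i <= j -> j <= l -> link i l = link i j :|: link j l.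
Proof. by move=> leij lejl; rewrite /link (big_cat_nat leij lejl). Qed.

(** The properties of a single linking set are inherited by unions; for the
    connectivity this is [conn_meet]. *)
Lemma linkP j l : j <= l -> l <= n ->
  [/\ link j l \subset A l :\: A j, skewed M (A j) (link j l),
      skewed M (B l) (link j l) & conn M (A j :|: link j l) (B l) = t].
Proof.
move=> lejl; elim: l lejl => [|l IHl].
  rewrite leqn0 => /eqP-> len; rewrite link0 setU0 chain_conn // sub0set.
  by rewrite /skewed !setU0 cards0 !addn0.
rewrite leq_eqVlt => /predU1P[-> len | lejl ltln].
  by rewrite link0 setU0 chain_conn // sub0set /skewed !setU0 cards0 !addn0.
have [sL skA skB cL] := IHl lejl (ltnW ltln).
have [sl skAl skBl cl] := link_ofP ltln.
rewrite link_recr //.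
have lelS : A l \subset A l.+1 by apply: chain_sub.
have lejA : A j \subset A l by apply: chain_sub => //; apply: ltnW.
have sLA : link j l \subset A l by apply: subset_trans sL (subsetDl _ _).
have djl : [disjoint link_of l & A l].
  by rewrite disjoints_subset (subset_trans sl) // setDE subsetIr.
have dLl : [disjoint link j l & link_of l].
  by rewrite disjoint_sym; apply: disjointWr djl.
have sBl : B l.+1 :|: link_of l \subset B l.
  rewrite subUset chain_coS //=; apply: subset_trans sl _.
  by apply: setSD; apply: chain_ground.
have skP : skewed M (A j :|: link j l) (link_of l).
  by apply: skew_sub skAl; rewrite subUset lejA.
split.
- rewrite subUset (subset_trans sL (setSD _ lelS)).
  exact: subset_trans sl (setDS _ lejA).
- exact: skewU dLl skA skP.
- rewrite setUC; apply: skewU skBl _; first by rewrite disjoint_sym.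
  exact: skew_sub sBl skB.
apply/eqP; rewrite eqn_leq; apply/andP; split.
  rewrite -(chain_conn ltln); apply: connSl; rewrite !subUset.
  rewrite (subset_trans lejA lelS) (subset_trans sLA lelS).
  exact: subset_trans sl (subsetDl _ _).
rewrite setUA conn_shift //.
apply: (@conn_meet _ M _ _ (A l) (B l)) => //.
- by rewrite subUset lejA.
- exact: chain_conn (ltnW ltln).
- by rewrite -conn_shift.
Qed.

Lemma link_skew_l j l X : j <= l -> l <= n -> X \subset A j -> skewed M X (link j l).
Proof. by move=> lejl leln sX; have [_ /(skew_sub sX)] := linkP lejl leln. Qed.

Lemma link_skew_r j l Y : j <= l -> l <= n -> Y \subset B l -> skewed M Y (link j l).
Proof. by move=> lejl leln sY; have [_ _ /(skew_sub sY)] := linkP lejl leln. Qed.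

Lemma link_subl j l : j <= l -> l <= n -> link j l \subset A l.
Proof.
by move=> lejl leln; have [sL _ _ _] := linkP lejl leln; apply: subset_trans sL (subsetDl _ _).
Qed.

Lemma link_subr j l : j <= l -> l <= n -> link j l \subset B j.
Proof.
move=> lejl leln; have [sL _ _ _] := linkP lejl leln.
by apply: subset_trans sL (setSD _ (chain_ground leln)).
Qed.

(** ** Recognising the trace on [A y] from the trace on [A x] *)

Lemma rank_setU1_le f W : r (f |: W) <= (r W).+1.
Proof.
by have := rank_subadd M [set f] W; have := rank_le_card M [set f]; rewrite cards1; lia.
Qed.

Lemma rank_setU1_sub f W W' :
  W \subset W' -> r (f |: W') != r W' -> r (f |: W) = (r W).+1.
Proof.
move=> sW; have := rank_margin M [set f] sW; rewrite !(setUC _ [set f]).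
have := rank_setU1_le f W; have := rankS M (subsetUr [set f] W').
by move=> h1 h2 h3 /eqP; move: h1 h2 h3; clear; lia.
Qed.

Section OneElement.
Variables (F : fieldType) (f : T) (x y : nat).
Hypotheses (lexy : x <= y) (leyn : y <= n) (fAx : f \in A x).

Let sAxAy : A x \subset A y. Proof. exact: chain_sub. Qed.
Let fAy : f \in A y. Proof. exact: (subsetP sAxAy). Qed.
Let fE : f \in E. Proof. exact: (subsetP (chain_ground leyn)). Qed.
Let fB i : x <= i -> i <= n -> f \notin B i.
Proof. by move=> lexi lein; rewrite inE negb_and negbK (subsetP (chain_sub lexi lein)). Qed.
Let fL : f \notin link x y.
Proof. by apply/negP => /(subsetP (link_subr lexy leyn)); apply/negP/fB; lia. Qed.

(** Deleting [f] may lower the dimension of an interface, and this has to happen at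
    [x] and at [y] alike, for the interface at [y] to be carried onto the one at
    [x]. This is ensured by asking that [f] be spanned by the rest of [A x] if and
    only if it is spanned by the rest of [A y]. *)
Lemma trace_eq_delete (vT : vectType F) (v : T -> vT) Z Z' :
    (forall W, W \subset E :\ f -> \dim (span_of v W) = r W) ->
    (r (A x :\ f) == r (A x)) = (r (A y :\ f) == r (A y)) ->
    Z \subset B y -> Z' \subset B y ->
    (span_of v (A x :\ f) :&: span_of v (Z :|: link x y)
       = span_of v (A x :\ f) :&: span_of v (Z' :|: link x y))%VS ->
  forall X, X \subset A y -> f \notin X -> conn M X Z = conn M X Z'.
Proof.
move=> repv eqbit sZ sZ' eqt X sX fX.
have {eqbit} rxy : r (A x :\ f) = r (A x) \/
    r (A x :\ f) < r (A x) /\ r (A y :\ f) < r (A y).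
  move: eqbit; have [-> | neqx] := eqVneq (r (A x :\ f)) (r (A x)); first by left.
  move/esym/negbT => neqy; right.
  by rewrite !ltn_neqAle neqx neqy !rankS ?subD1set.
have rk W : W \subset E -> f \notin W -> \dim (span_of v W) = r W.
  by move=> sW fW; rewrite repv // subsetD1 sW.
have cn W W' : W \subset E -> f \notin W -> W' \subset E -> f \notin W' ->
    \dim (span_of v W :&: span_of v W')%VS = conn M W W'.
  move=> sW fW sW' fW'; have := dim_cap_span_of v W W'.
  rewrite (rk _ sW fW) (rk _ sW' fW') rk ?subUset ?sW // ?in_setU ?negb_or ?fW //.
  by rewrite /conn => <-; rewrite addnK.
have sAyE := chain_ground leyn; have sByE : B y \subset E by apply: subsetDl.
have fBy := fB lexy leyn.
have fsub W W' : W \subset W' -> f \notin W' -> f \notin W.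
  by move=> sW; apply: contra; apply: (subsetP sW).
have sXE := subset_trans sX sAyE.
have sZE := subset_trans sZ sByE; have sZE' := subset_trans sZ' sByE.
have fZ := fsub _ _ sZ fBy; have fZ' := fsub _ _ sZ' fBy.
rewrite -(cn _ _ sXE fX sZE fZ) -(cn _ _ sXE fX sZE' fZ').
apply: (@dim_trace_eq _ _ _ _ (A y :\ f)); first by rewrite subsetD1 sX.
have sL : link x y \subset A y by apply: link_subl.
have sLE := subset_trans sL sAyE.
have skL := link_skew_r lexy leyn (subxx _).
apply: (@trace_eq F T vT v (A x :\ f) (A y :\ f) (B y) (link x y)) => //.
- by rewrite subUset setSD // subsetD1 sL.
- have fAxf : f \notin A x :\ f :|: link x y by rewrite !inE eqxx (negbTE fL).
  have sAyf : A y :\ f \subset E := subset_trans (subD1set _ _) sAyE.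
  have sAxL : A x :\ f :|: link x y \subset E.
    by rewrite subUset sLE (subset_trans (setSD _ sAxAy) sAyf).
  have fAyf : f \notin A y :\ f by rewrite setD11.
  rewrite (cn _ _ sAyf fAyf sByE fBy) (cn _ _ sAxL fAxf sByE fBy).
  have cAy := chain_conn leyn; have [_ skA _ cL] := linkP lexy leyn.
  have sUE : A y :|: B y = E by rewrite -{1}(setIidPr sAyE) setID.
  have Dy := connE M (A y) (B y); rewrite cAy sUE in Dy.
  have [rx | [ltx ry]] := rxy.
    have abs W : r (A x :\ f :|: W) = r (A x :|: W).
      have := rank_margin M W (subD1set (A x) f).
      have := rankS M (setSU W (subD1set (A x) f)); rewrite rx; clear; lia.
    have -> : conn M (A x :\ f :|: link x y) (B y) = t.
      by rewrite -cL /conn -(setUA (A x)) -setUA !abs.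
    by rewrite -cAy connSl // subD1set.
  have rank1 W : f \in W -> r W <= (r (W :\ f)).+1.
    move=> fW; have := rank_subadd M [set f] (W :\ f); rewrite setD1K //.
    by have := rank_le_card M [set f]; rewrite cards1; clear; lia.
  (* Both connectivities drop by one, unless [f] is a coloop of [M], in which case
     neither drops. *)
  have D1 := connE M (A y :\ f) (B y); have D2 := connE M (A x :\ f :|: link x y) (B y).
  have D3 := connE M (A x :|: link x y) (B y).
  have D4 : r (A x :\ f :|: link x y) = r (A x :\ f) + #|link x y|.
    by apply/eqP; apply: skew_sub skA; apply: subD1set.
  have D5 := eqP skA; have D6 := rank1 _ fAy; have D7 := rank1 _ fAx.
  have eE : A y :\ f :|: B y = E :\ f.
    by rewrite -sUE setDUl; congr (_ :|: _); apply/esym/setDidPl; rewrite disjoint_sym disjoints1.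
  rewrite eE in D1.
  have fAll : [set f] :|: (A x :\ f :|: link x y :|: B y) = A x :|: link x y :|: B y.
    by rewrite !setUA setD1K.
  have sW : A x :\ f :|: link x y :|: B y \subset E :\ f.
    by rewrite subsetD1 subUset sAxL sByE in_setU negb_or fAxf fBy.
  have := rank_margin M [set f] sW; rewrite setUC setD1K // (setUC _ [set f]) fAll.
  by rewrite cL in D3; move: D1 D2 D3 D4 D5 D6 D7 ltx ry Dy; clear; lia.
- rewrite (cn _ _ sByE fBy sLE fL).
  by have := connE M (B y) (link x y); rewrite (eqP skL) (skew_rank skL); clear; lia.
Qed.

(** After contraction of [f], the linking set remains skew to [B y] if [f] is
    spanned by [B y], or if it is not even spanned by [B x]. The local
    connectivities with [X] differ from those with [X :\ f] in the contraction by
    whether [f] is spanned by [Z]. *)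
Lemma trace_eq_contract (vT : vectType F) (v : T -> vT) Z Z' :
    (forall W, W \subset E :\ f -> \dim (span_of v W) + r [set f] = r (f |: W)) ->
    (r (f |: B x) == r (B x)) = (r (f |: B y) == r (B y)) ->
    Z \subset B y -> Z' \subset B y ->
    (r (f |: Z) == r Z) = (r (f |: Z') == r Z') ->
    (span_of v (A x :\ f) :&: span_of v (Z :|: link x y)
       = span_of v (A x :\ f) :&: span_of v (Z' :|: link x y))%VS ->
  forall X, X \subset A y -> f \in X -> conn M X Z = conn M X Z'.
Proof.
move=> rk eqbit sZ sZ' eqZ eqt X sX fX.
have {rk} cn W W' : W \subset E :\ f -> W' \subset E :\ f ->
    \dim (span_of v W :&: span_of v W')%VS + r (f |: (W :|: W')) + r [set f]
      = r (f |: W) + r (f |: W').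
  move=> sW sW'; have := dim_cap_span_of v W W'.
  rewrite -!rk ?subUset ?sW //; do ![move: (\dim _) => ?]; clear; lia.
have sAyE := chain_ground leyn; have sByE : B y \subset E by apply: subsetDl.
have sByf : B y \subset E :\ f by rewrite subsetD1 sByE fB.
have sXf : X :\ f \subset E :\ f by apply: setSD; apply: subset_trans sX sAyE.
have sL : link x y \subset A y by apply: link_subl.
have sLf : link x y \subset E :\ f by rewrite subsetD1 fL (subset_trans sL).
have key : (span_of v (A y :\ f) :&: span_of v Z
            = span_of v (A y :\ f) :&: span_of v Z')%VS.
  apply: (@trace_eq F T vT v (A x :\ f) (A y :\ f) (B y) (link x y)) => //.
  - by rewrite subUset setSD // subsetD1 sL.
  - have sAyf : A y :\ f \subset E :\ f by apply: setSD.
    have sAxL : A x :\ f :|: link x y \subset E :\ f.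
      by rewrite subUset sLf (subset_trans (setSD _ sAxAy)).
    have := cn _ _ sAyf sByf; have := cn _ _ sAxL sByf.
    rewrite !setUA !setD1K //.
    have [_ _ _ cL] := linkP lexy leyn; have := chain_conn leyn.
    have := connE M (A y) (B y); have := connE M (A x :|: link x y) (B y); rewrite cL.
    by do 2![move: (\dim _) => ?]; clear; lia.
  have skB := link_skew_r lexy leyn (subxx _); have rL := skew_rank skB.
  have := cn _ _ sByf sLf; have := eqP skB.
  have fL1 := rank_subadd M [set f] (link x y).
  have fB1 := rank_subadd M [set f] (B y).
  have f1 := rank_le_card M [set f]; rewrite cards1 in f1.
  have sW : B y :|: link x y \subset B x by rewrite subUset chain_coS ?link_subr.
  have [eqB | neqB] := eqVneq (r (f |: B y)) (r (B y)).
    have := rankS M (subsetUr [set f] (B y :|: link x y)).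
    by move: (\dim _) fL1 f1 rL eqB => ?; clear; lia.
  have neqBx : r (f |: B x) != r (B x) by rewrite eqbit.
  have := rank_setU1_sub sW neqBx.
  by move: (\dim _) fL1 fB1 f1 rL => ?; clear; lia.
have sZf := subset_trans sZ sByf; have sZf' := subset_trans sZ' sByf.
have sXA : X :\ f \subset A y :\ f by apply: setSD.
have := cn _ _ sXf sZf; have := cn _ _ sXf sZf'; rewrite (dim_trace_eq sXA key).
rewrite !setUA !setD1K //.
have := connE M X Z; have := connE M X Z'.
have [eZ | nZ] := eqVneq (r (f |: Z)) (r Z).
  have eZ' : r (f |: Z') = r Z' by apply/eqP; rewrite -eqZ; apply/eqP.
  by rewrite eZ eZ'; move: (\dim _) => ?; clear; lia.
have nZ' : r (f |: Z') != r Z' by rewrite -eqZ.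
rewrite (rank_setU1_sub (subxx _) nZ) (rank_setU1_sub (subxx _) nZ').
by move: (\dim _) => ?; clear; lia.
Qed.

End OneElement.

(** The subsets of [A y] that avoid [f] are tested in a representation [v0] of
    [M \ f], those that contain [f] in a representation [v1] of [M / f]; between
    the two, all subsets are covered although [M] itself has no representation. *)
Lemma conn_eq_of_labels (F : fieldType) f x y w (U0 U1 : vectType F)
    (v0 : T -> U0) (v1 : T -> U1) Y Y' :
    x <= y -> y <= w -> w <= n -> f \in A x ->
    (forall W, W \subset E :\ f -> \dim (span_of v0 W) = r W) ->
    (forall W, W \subset E :\ f -> \dim (span_of v1 W) + r [set f] = r (f |: W)) ->
    (r (A x :\ f) == r (A x)) = (r (A y :\ f) == r (A y)) ->
    (r (f |: B x) == r (B x)) = (r (f |: B y) == r (B y)) ->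
    (r (f |: B y) == r (B y)) = (r (f |: B w) == r (B w)) ->
    Y \subset B y -> Y' \subset B w ->
    (r (f |: Y) == r Y) = (r (f |: Y') == r Y') ->
    (span_of v0 (A x :\ f) :&: span_of v0 (Y :|: link x y)
       = span_of v0 (A x :\ f) :&: span_of v0 (Y' :|: link x w))%VS ->
    (span_of v1 (A x :\ f) :&: span_of v1 (Y :|: link x y)
       = span_of v1 (A x :\ f) :&: span_of v1 (Y' :|: link x w))%VS ->
  forall X, X \subset A y -> conn M X Y = conn M X (Y' :|: link y w).
Proof.
move=> lexy leyw lewn fA rk0 rk1 bitA bitB bitB' sY sY' bitY tr0 tr1 X sX.
have leyn := leq_trans leyw lewn.
have eqL : Y' :|: link x w = Y' :|: link y w :|: link x y.
  by rewrite (link_cat lexy leyw) -setUA (setUC (link y w)).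
have sZ : Y' :|: link y w \subset B y.
  by rewrite subUset link_subr // (subset_trans sY') // chain_coS.
rewrite eqL in tr0 tr1.
have [fX | fX] := boolP (f \in X); last first.
  exact: (trace_eq_delete (f := f) lexy leyn fA rk0 bitA sY sZ tr0).
apply: (trace_eq_contract (f := f) lexy leyn fA rk1 bitB sY sZ _ tr1) => //.
rewrite bitY; have [eB | nB] := eqVneq (r (f |: B w)) (r (B w)).
  have skf : skewed M (f |: B w) (link y w).
    have := eqP (link_skew_r leyw lewn (subxx (B w))).
    have := rankS M (setSU (link y w) (subsetUr [set f] (B w))).
    have := rank_subadd M (f |: B w) (link y w); have := rank_le_card M (link y w).
    by rewrite /skewed eB => h1 h2 h3 h4; apply/eqP; move: h1 h2 h3 h4; clear; lia.
  have := eqP (skew_sub (setUS [set f] sY') skf).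
  have := eqP (skew_sub sY' (link_skew_r leyw lewn (subxx (B w)))).
  by rewrite setUA => -> ->; rewrite eqn_add2r.
have nBy : r (f |: B y) != r (B y) by rewrite bitB'.
rewrite (rank_setU1_sub sZ nBy) (rank_setU1_sub sY' nB).
by clear; apply/idP/idP; lia.
Qed.

End LinkedChain.

(** * Excluded minors have no long linked chains *)

Lemma minor_representation (F : fieldType) (T : finType) (M : matroid T) (C D : {set T}) :
    excluded_minor (@representable T F) M ->
    C \subset ground M -> D \subset ground M -> [disjoint C & D] -> C :|: D != set0 ->
  exists m (v : T -> 'cV[F]_m), forall X : {set T}, X \subset ground M :\: C :\: D ->
    \dim (span_of v X) + rank M C = rank M (X :|: C).
Proof.
move=> [_ repM] sC sD dCD CD0.
have [|m [v repv]] := @representable_rank F T (delete (contract M C) D).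
  by apply: repM; exists C, D.
by exists m, v => X sX; rewrite repv // rank_minor.
Qed.

(** A nonempty proper separation of order 0 cuts [M] into two representable
    minors, of which [M] is the direct sum. *)
Lemma excluded_minor_connected (F : fieldType) (T : finType) (M : matroid T) (A : {set T}) :
    excluded_minor (@representable T F) M -> A \subset ground M -> A != set0 ->
    A != ground M -> connectivity M A != 0.
Proof.
move=> exM sA A0 AE; apply/eqP; rewrite connectivityE // => cA.
have B0 : ground M :\: A != set0.
  by apply: contra AE; rewrite setD_eq0 eqEsubset sA => ->.
have rk (D : {set T}) : D \subset ground M -> D != set0 -> exists m (v : T -> 'cV[F]_m),
    forall X : {set T}, X \subset ground M :\: D -> \dim (span_of v X) = rank M X.
  move=> sD D0; have [||||m [v rkv]] := @minor_representation F T M set0 D exM.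
  - exact: sub0set.
  - exact: sD.
  - by rewrite -setI_eq0 set0I.
  - by rewrite set0U.
  exists m, v => X sX; have := rkv X; rewrite setD0 setU0 rank_set0 addn0.
  by apply.
have [m1 [v1 rk1]] := rk _ (subsetDl _ A) B0; have [m2 [v2 rk2]] := rk _ sA A0.
have [nrepM _] := exM; apply: nrepM.
apply: (@glue_representations F T M _ _ 'rV[F]_0 v1 v2 0%VS 0%R 0%R A).
- by apply/lker0P => u w _; apply/rowP => -[].
- move=> X sX; rewrite addv0 dimv0 rk1 ?(addn0 : right_id 0%R addn) //.
  by rewrite setDDr setDv set0U subsetI (subset_trans sX sA).
- by move=> Y sY; rewrite rk2.
move=> X Y sX sY; have : conn M X Y <= 0.
  by rewrite -cA; apply: leq_trans (connSl _ _ sX) (connSr _ _ sY).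
rewrite leqn0 => /eqP->; apply/eqP; rewrite dimv_eq0 -subv0; apply/subvP => u _.
by rewrite memv0; apply/eqP/rowP => -[].
Qed.

Section LinkedChainBound.
Variables (F : finFieldType) (T : finType) (M : matroid T).
Variables (A : nat -> {set T}) (n t : nat).
Hypothesis exM : excluded_minor (@representable T F) M.
Hypothesis chainA : linked_chain M A n t.
Implicit Types (X Y W : {set T}).
Local Notation E := (ground M).
Local Notation r := (rank M).
Let B i := E :\: A i.
Local Notation code_t := 'M[F]_(dim 'rV[F]_t).
Local Notation label := (code_t * code_t * code_t * bool)%type.

(** The minor obtained by contracting [link_of M A t l] onto [A l] and [B l.+1],
    and coordinates on its interface. *)
Lemma step_representation l : l < n ->
  exists m (v : T -> 'cV[F]_m) (i : 'Hom('rV[F]_t, 'cV[F]_m)),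
    [/\ forall W, W \subset A l :|: B l.+1 ->
          \dim (span_of v W) + #|link_of M A t l| = r (W :|: link_of M A t l),
        lker i == 0%VS
      & limg i = (span_of v (A l) :&: span_of v (B l.+1))%VS].
Proof.
move=> ltln; have [sC skA skB cC] := link_ofP chainA ltln.
set C := link_of M A t l in sC skA skB cC *; rewrite -/(B l.+1) in skB cC.
have [sA ltA _ _] := chainA.
have sAl := sA l (ltnW ltln); have sAl1 := sA l.+1 ltln.
have sCA : C \subset A l.+1 by apply: subset_trans sC (subsetDl _ _).
have [||||m [v rkv]] := @minor_representation F T M C (A l.+1 :\: A l :\: C) exM.
- exact: subset_trans sCA sAl1.
- by rewrite setDDl; apply: subset_trans (subsetDl _ _) sAl1.
- by rewrite disjoint_sym disjoints_subset setDE subsetIr.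
- rewrite -{1}(setIidPr sC) setID.
  by case/properP: (ltA l ltln) => _ [z zA1 zA]; apply/set0Pn; exists z; rewrite inE zA.
have rk W : W \subset A l :|: B l.+1 -> \dim (span_of v W) + #|C| = r (W :|: C).
  move=> sW; rewrite -(skew_rank skA) rkv //; apply: subset_trans sW _.
  apply/subsetP => x; rewrite !inE.
  have := subsetP sC x; rewrite !inE; have := subsetP sAl x.
  have := subsetP (proper_sub (ltA l ltln)) x.
  by case: (x \in A l); case: (x \in A l.+1); case: (x \in C); case: (x \in E) => //=
     h1 h2 h3; try (by have := h1 isT); try (by have := h2 isT); try (by have := h3 isT).
have dimW : \dim (span_of v (A l) :&: span_of v (B l.+1)) = t.
  have := dim_cap_span_of v (A l) (B l.+1).
  have := rk _ (subsetUl (A l) (B l.+1)); have := rk _ (subsetUr (A l) (B l.+1)).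
  have := rk _ (subxx _); rewrite (eqP skA) (eqP skB).
  have := connE M (A l :|: C) (B l.+1); rewrite cC (eqP skA).
  have -> : A l :|: B l.+1 :|: C = A l :|: C :|: B l.+1 by rewrite setUAC.
  by do ![move: (\dim _) => ?]; clear; lia.
have [|i iW] := @exists_lfun_onto F 'rV[F]_t _ (span_of v (A l) :&: span_of v (B l.+1))%VS.
  by rewrite dimW dim_matrix -[(1 * t)%R]/(1 * t)%N mul1n.
exists m, v, i; split=> //.
have := limg_ker_dim i fullv; rewrite iW dimW capfv dimvf dim_matrix -[(1 * t)%R]/(1 * t)%N.
by rewrite mul1n -dimv_eq0; move: (\dim _) => d /eqP; rewrite -{2}(add0n t) eqn_add2r.
Qed.


Section Types.
Variable f : T.
Hypothesis fA : f \in A 1.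

(** By [trace_eq_delete] and [trace_eq_contract], traces can be transported between
    interfaces with equal bits. *)
Definition bits l : bool * bool :=
  (r (f |: B l.+1) == r (B l.+1), r (A l.+1 :\ f) == r (A l.+1)).

(** Traces are compared at the first interface with the given bits. *)
Definition base b := find (fun i => bits i == b) (iota 0 n).

Lemma baseP l : l < n -> base (bits l) <= l /\ bits (base (bits l)) = bits l.
Proof.
move=> ltln; have hasl : has (fun i => bits i == bits l) (iota 0 n).
  by apply/hasP; exists l; rewrite ?mem_iota.
have ltb : base (bits l) < n by rewrite /base -[X in _ < X](size_iota 0 n) -has_find.
split; last by apply/eqP; have := nth_find 0 hasl; rewrite nth_iota.
rewrite leqNgt; apply/negP => ltlb.
by have := before_find 0 ltlb; rewrite nth_iota // eqxx.
Qed.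

Variables (m0 m1 : nat) (v0 : T -> 'cV[F]_m0) (v1 : T -> 'cV[F]_m1).
Hypothesis rk0 : forall W, W \subset E :\ f -> \dim (span_of v0 W) = r W.
Hypothesis rk1 : forall W, W \subset E :\ f ->
  \dim (span_of v1 W) + r [set f] = r (f |: W).

Definition trace m (v : T -> 'cV[F]_m) l Y :=
  let x := (base (bits l)).+1 in
  (span_of v (A x :\ f) :&: span_of v (Y :|: link M A t x l.+1))%VS.

Let fB l : f \notin B l.+1 \/ n <= l.
Proof.
have [lenl | ltln] := leqP n l; [by right | left].
by rewrite inE (subsetP (chain_sub chainA (ltn0Sn l) ltln)).
Qed.

Let sBf l : l < n -> B l.+1 \subset E :\ f.
Proof. by move=> ltln; rewrite subsetD1 subsetDl; case: (fB l) => //; lia. Qed.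

Let sAf l : l < n -> A l.+1 :\ f \subset E :\ f.
Proof. by move=> ltln; apply/setSD/(chain_ground chainA). Qed.

Definition first_space m (v : T -> 'cV[F]_m) b :=
  (span_of v (A (base b).+1 :\ f) :&: span_of v (B (base b).+1))%VS.

Lemma dim_first_delete l : l < n -> \dim (first_space v0 (bits l)) <= t.
Proof.
move=> ltln; have [lexl _] := baseP ltln; have ltxn := leq_ltn_trans lexl ltln.
rewrite /first_space; set x := base _ in ltxn *.
have := dim_cap_span_of v0 (A x.+1 :\ f) (B x.+1).
rewrite !rk0 ?subUset ?sAf ?sBf // => eqd.
have := connSl M (B x.+1) (subD1set (A x.+1) f); rewrite (chain_conn chainA) //.
have := connE M (A x.+1 :\ f) (B x.+1).
by move: (\dim _) eqd => d; clear; lia.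
Qed.

Lemma dim_first_contract l : l < n -> \dim (first_space v1 (bits l)) <= t.
Proof.
move=> ltln; have [lexl _] := baseP ltln; have ltxn := leq_ltn_trans lexl ltln.
rewrite /first_space; set x := base _ in ltxn *.
have fAx : f \in A x.+1 by apply: (subsetP (chain_sub chainA (ltn0Sn x) ltxn)).
have := dim_cap_span_of v1 (A x.+1 :\ f) (B x.+1).
have := rk1 (sAf ltxn); have := rk1 (sBf ltxn).
have := rk1 (_ : A x.+1 :\ f :|: B x.+1 \subset E :\ f).
rewrite subUset sAf ?sBf // setUA !setD1K // => /(_ isT).
have := rank_subadd M [set f] (B x.+1).
have := connE M (A x.+1) (B x.+1); rewrite (chain_conn chainA) //.
by do ![move: (\dim _) => ?]; clear; lia.
Qed.

Lemma trace_sub m (v : T -> 'cV[F]_m) l Y : l < n -> Y \subset B l.+1 ->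
  (trace v l Y <= first_space v (bits l))%VS.
Proof.
move=> ltln sY; have [lexl _] := baseP ltln.
apply: capvS => //; apply: span_ofS; rewrite subUset.
rewrite (subset_trans sY) ?(chain_coS chainA) //=.
exact: (link_subr chainA).
Qed.

Lemma exists_trace_code m (v : T -> 'cV[F]_m) :
    (forall l, l < n -> \dim (first_space v (bits l)) <= t) ->
  exists code : bool * bool -> {vspace 'cV[F]_m} -> code_t,
    forall l Y l' Y', l < n -> l' < n -> bits l = bits l' ->
      Y \subset B l.+1 -> Y' \subset B l'.+1 ->
      code (bits l) (trace v l Y) = code (bits l') (trace v l' Y') ->
    trace v l Y = trace v l' Y'.
Proof.
move=> dimv.
have /fin_all_exists[code codeP] : forall b : bool * bool,
    exists code : {vspace 'cV[F]_m} -> code_t, \dim (first_space v b) <= t ->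
      forall S S', (S <= first_space v b)%VS -> (S' <= first_space v b)%VS ->
      code S = code S' -> S = S'.
  move=> b; have [/exists_subspace_code[code codeP] | _] := leqP (\dim (first_space v b)) t.
    by exists code.
  by exists (fun _ => 0%R).
exists code => l Y l' Y' ltln ltln' eqb sY sY' eqc.
apply: (codeP (bits l)); first exact: dimv.
- exact: trace_sub.
- by rewrite eqb; apply: trace_sub.
by rewrite eqc eqb.
Qed.

Variables (code0 : bool * bool -> {vspace 'cV[F]_m0} -> code_t)
          (code1 : bool * bool -> {vspace 'cV[F]_m1} -> code_t).

(** For given bits, the components other than the third determine the local
    connectivities of [Y] with the sets on the left of the interface, in [M]; the
    third one is the position of [Y] in a representation of the minor attached to
    the interface. *)
Definition label_of m (v : T -> 'cV[F]_m) (i : 'Hom('rV[F]_t, 'cV[F]_m)) l Y : label :=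
  (code0 (bits l) (trace v0 l Y), code1 (bits l) (trace v1 l Y),
   vs2mx (i @^-1: span_of v Y)%VS, r (f |: Y) == r Y).

(** The type of an interface, besides its bits. It depends on the representation
    of the minor attached to the interface, of which any one will do. *)
Definition has_labels l (S : {set label}) : Prop :=
  exists m (v : T -> 'cV[F]_m) (i : 'Hom('rV[F]_t, 'cV[F]_m)),
    [/\ forall W, W \subset A l :|: B l.+1 ->
          \dim (span_of v W) + #|link_of M A t l| = r (W :|: link_of M A t l),
        lker i == 0%VS,
        limg i = (span_of v (A l) :&: span_of v (B l.+1))%VS
      & S = [set label_of v i l Y | Y in powerset (B l.+1)]].

Hypothesis code0P : forall l Y l' Y', l < n -> l' < n -> bits l = bits l' ->
  Y \subset B l.+1 -> Y' \subset B l'.+1 ->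
  code0 (bits l) (trace v0 l Y) = code0 (bits l') (trace v0 l' Y') ->
  trace v0 l Y = trace v0 l' Y'.
Hypothesis code1P : forall l Y l' Y', l < n -> l' < n -> bits l = bits l' ->
  Y \subset B l.+1 -> Y' \subset B l'.+1 ->
  code1 (bits l) (trace v1 l Y) = code1 (bits l') (trace v1 l' Y') ->
  trace v1 l Y = trace v1 l' Y'.

(** The left part is taken from the minor attached to [l], contracted down to
    [A j.+1], and the right part from the minor attached to [j]. A set [Y] on the
    right is placed on the common space as some [Y'] with the same label at [l]
    is. Now [X] and [Y'] are both present in the minor attached to [l], where
    they meet in the dimension prescribed by [M] for [X] and [Y'] together with
    the linking set, hence, by equality of the other components, for [X] and
    [Y]. *)
Lemma glue_alike j l S : j < l -> l < n -> bits j = bits l ->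
  has_labels j S -> has_labels l S -> representable F M.
Proof.
move=> ltjl ltln eqb [mj [vj [ij [rkj ijinj imj eqSj]]]] [ml [vl [il [rkl ilinj iml eqSl]]]].
have ltjn := ltn_trans ltjl ltln.
pose x := (base (bits j)).+1; have [lexj bitsx] := baseP ltjn.
have [skAl skBl] : skewed M (A l) (link_of M A t l) /\ skewed M (B l.+1) (link_of M A t l).
  by have [] := link_ofP chainA ltln.
have skBj : skewed M (B j.+1) (link_of M A t j) by have [] := link_ofP chainA ltjn.
have eqL : link M A t j.+1 l.+1 = link M A t j.+1 l :|: link_of M A t l.
  by rewrite link_recr.
have sLA : link M A t j.+1 l \subset A l by apply: (link_subl chainA) => //; apply: ltnW.
have sAjl : A j.+1 \subset A l by apply: (chain_sub chainA) => //; apply: ltnW.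
have rkL X : X \subset A j.+1 ->
    \dim (span_of vl (X :|: link M A t j.+1 l)) + #|link_of M A t l|
      = r X + #|link M A t j.+1 l.+1|.
  move=> sX; rewrite rkl.
    by rewrite -setUA -eqL; apply/eqP; apply: (link_skew_l chainA) => //; apply: ltnW.
  by rewrite subUset !(subset_trans _ (subsetUl _ _)) // (subset_trans sX).
apply: (@glue_representations F T M _ _ _ vl vj
          (span_of vl (link M A t j.+1 l)) il ij (A j.+1)) => //.
- move=> X sX; rewrite -span_ofU.
  have := rkL X sX; have := rkL set0 (sub0set _); rewrite set0U rank_set0.
  by do 2![move: (\dim _) => ?]; clear; lia.
- move=> Y sY; apply/eqP; rewrite -(eqn_add2r #|link_of M A t j|) rkj.
    by rewrite (eqP (skew_sub sY skBj)).
  exact: subset_trans sY (subsetUr _ _).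
move=> X Y sX sY; rewrite -span_ofU.
have : label_of vj ij j Y \in S by rewrite eqSj imset_f // powersetE.
rewrite eqSl => /imsetP[Y']; rewrite powersetE => sY' /eqP.
rewrite !xpair_eqE => /andP[/andP[/andP[/eqP eq0 /eqP eq1] /eqP/val_inj eqi] /eqP eqf].
rewrite eqi; set X' := X :|: link M A t j.+1 l.
have sX' : X' \subset A l by rewrite subUset sLA (subset_trans sX).
have -> : \dim (il @^-1: span_of vl X' :&: il @^-1: span_of vl Y')
        = \dim (span_of vl X' :&: span_of vl Y').
  rewrite -(limg_dim_eq (f := il)) ?(eqP ilinj) ?capv0 //; congr (\dim _).
  apply/vspaceP => u; rewrite memv_cap; apply/memv_imgP/andP => [[w] | [uX uY]].
    by rewrite memv_cap -!memv_preim => /andP[wX wY] ->.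
  have : u \in limg il.
    by rewrite iml memv_cap (subvP (span_ofS vl sX') _ uX) (subvP (span_ofS vl sY') _ uY).
  move=> /memv_imgP[w _ eqw]; exists w => //.
  by rewrite memv_cap -!memv_preim -eqw uX.
have ltxn : x <= n by apply: leq_ltn_trans lexj ltjn.
have tr0 := code0P ltjn ltln eqb sY sY' eq0; have tr1 := code1P ltjn ltln eqb sY sY' eq1.
rewrite /trace -eqb -/x in tr0 tr1.
have [bitsA bitsB] : (r (f |: B x) == r (B x)) = (r (f |: B j.+1) == r (B j.+1))
    /\ (r (A x :\ f) == r (A x)) = (r (A j.+1 :\ f) == r (A j.+1)).
  by case: bitsx.
have [bitsB' _] : (r (f |: B j.+1) == r (B j.+1)) = (r (f |: B l.+1) == r (B l.+1))
    /\ (r (A j.+1 :\ f) == r (A j.+1)) = (r (A l.+1 :\ f) == r (A l.+1)).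
  by case: eqb.
have fAx : f \in A x by apply: (subsetP (chain_sub chainA (ltn0Sn _) ltxn)).
have lejl : j.+1 <= l.+1 by apply: ltnW.
rewrite (conn_eq_of_labels chainA _ lejl _ fAx rk0 rk1 bitsB bitsA bitsB' sY sY' eqf tr0 tr1) //.
have := dim_cap_span_of vl X' Y'.
have := rkL X sX; rewrite -/X'.
have := rkl Y' (subset_trans sY' (subsetUr _ _)); rewrite (eqP (skew_sub sY' skBl)).
have := rkl (X' :|: Y') (setUSS sX' sY').
have -> : X' :|: Y' :|: link_of M A t l = X :|: (Y' :|: link M A t j.+1 l.+1).
  by rewrite eqL /X' (setUC Y') -!setUA (setUC Y').
have := connE M X (Y' :|: link M A t j.+1 l.+1).
have := eqP (link_skew_r chainA (_ : j.+1 <= l.+1) ltln sY') => ->; last by [].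
by do ![move: (\dim _) => ?]; clear; lia.
Qed.

End Types.

(** Two interfaces with the same type would represent [M] by [glue_alike]. There are
    [2 ^ 2] pairs of bits, and a label consists of three matrices of order [t] and
    one more bit. *)
Theorem linked_chain_bound : n <= 2 ^ (2 * (#|F| ^ (t * t)) ^ 3 + 2).
Proof.
have [-> // | n_gt0] := posnP n.
have [sA ltA _ _] := chainA.
(* Since [f] lies in all the [A l] with [0 < l], it is never on the right. *)
have [f fA _] : exists2 f, f \in A 1 & f \notin A 0 by case/properP: (ltA 0 n_gt0).
have fE : f \in E by apply: (subsetP (chain_ground chainA n_gt0)).
have f0 : [set f] != set0 :> {set T} by apply/set0Pn; exists f; rewrite inE.
have sfE : [set f] \subset E by rewrite sub1set.
have [||||m0 [v0 rk0]] := @minor_representation F T M set0 [set f] exM.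
- exact: sub0set.
- exact: sfE.
- by rewrite -setI_eq0 set0I.
- by rewrite set0U.
have [||||m1 [v1 rk1]] := @minor_representation F T M [set f] set0 exM.
- exact: sfE.
- exact: sub0set.
- by rewrite -setI_eq0 setI0.
- by rewrite setU0.
have {}rk0 W : W \subset E :\ f -> \dim (span_of v0 W) = r W.
  by move=> sW; have := rk0 W; rewrite setD0 rank_set0 addn0 setU0; apply.
have {}rk1 W : W \subset E :\ f -> \dim (span_of v1 W) + r [set f] = r (f |: W).
  by move=> sW; have := rk1 W; rewrite setD0 setUC; apply.
have [code0 code0P] := exists_trace_code (dim_first_delete fA rk0).
have [code1 code1P] := exists_trace_code (dim_first_contract fA rk1).
have /fin_all_exists[S SP] : forall l : 'I_n, exists S : {set label},
    has_labels f v0 v1 code0 code1 l S.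
  move=> l; have [m [v [i [rkv iinj imi]]]] := step_representation (ltn_ord l).
  by eexists; exists m, v, i; split.
pose type_of (l : 'I_n) := (bits f l, S l).
have [inj | /injectivePn] := boolP (injectiveb type_of).
  have := leq_card type_of (injectiveP _ inj); rewrite card_ord => /leq_trans; apply.
  have cS : #|{: {set label}}| = 2 ^ #|{: label}|.
    by rewrite -cardsT -powersetT card_powerset cardsT.
  rewrite card_prod cS !card_prod !card_bool !card_mx.
  rewrite dim_matrix -[(1 * t)%R]/(1 * t)%N mul1n.
  set x := #|F| ^ (t * t); rewrite [X in X <= _]mulnC expnD leq_mul // leq_exp2l //.
  by rewrite mulnC !expnS expn0 muln1 !mulnA.
case=> j [l neqjl /eqP]; rewrite xpair_eqE => /andP[/eqP eqb /eqP eqS].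
have [nrep _] := exM; case: nrep.
wlog ltjl : j l neqjl eqb eqS / j < l.
  move=> gl; have [ltjl | ltlj | /val_inj eqjl] := ltngtP j l.
  - exact: (gl j l).
  - by apply: (gl l j) => //; rewrite eq_sym.
  - by rewrite eqjl eqxx in neqjl.
apply: (glue_alike fA rk0 rk1 code0P code1P ltjl (ltn_ord l) eqb (SP j)).
by rewrite eqS; apply: SP.
Qed.

End LinkedChainBound.

(** * Chains of separations of bounded order *)

Section Chains.
Variable T : finType.
Implicit Types (P Q X Y Z : {set T}) (S : {set {set T}}).

Definition set_chain S : Prop :=
  {in S &, forall X Y, (X \subset Y) || (Y \subset X)}.

Lemma set_chainS S S' : S' \subset S -> set_chain S -> set_chain S'.
Proof. by move=> /subsetP sS chS X Y /sS XS /sS YS; apply: chS. Qed.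

Lemma set_chain_image (f : {set T} -> {set T}) S :
  {homo f : X Y / X \subset Y} -> set_chain S -> set_chain (f @: S).
Proof.
move=> homf chS _ _ /imsetP[X XS ->] /imsetP[Y YS ->].
by have /orP[/homf-> | /homf->] := chS X Y XS YS; rewrite ?orbT.
Qed.

Lemma set_chain_max S : set_chain S -> S != set0 ->
  exists2 Q, Q \in S & {in S, forall Y, Y \subset Q}.
Proof.
move=> chS /set0Pn[Y0 Y0S].
have [Q QS maxQ] := arg_maxnP (fun Y : {set T} => #|Y|) Y0S.
exists Q => // Y YS; have /orP[// | sQY] := chS Y Q YS QS.
have /eqP-> // : Q == Y by rewrite eqEcard sQY; apply: maxQ.
Qed.

Lemma set_chain_min S : set_chain S -> S != set0 ->
  exists2 P, P \in S & {in S, forall Y, P \subset Y}.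
Proof.
move=> chS /set0Pn[Y0 Y0S].
have [P PS minP] := arg_minnP (fun Y : {set T} => #|Y|) Y0S.
exists P => // Y YS; have /orP[// | sYP] := chS P Y PS YS.
have /eqP-> // : Y == P by rewrite eqEcard sYP; apply: minP.
Qed.

Lemma set_chain_enum S n : set_chain S -> #|S| = n.+1 ->
  exists A : nat -> {set T}, (forall i, i <= n -> A i \in S) /\
                             (forall i, i < n -> A i \proper A i.+1).
Proof.
elim: n S => [|n IHn] S chS cS; have [] := set_chain_max chS.
- by rewrite -card_gt0 cS.
- by move=> Q QS _; exists (fun _ => Q).
- by rewrite -card_gt0 cS.
move=> Q QS maxQ; have [|| A [AS ltA]] := IHn (S :\ Q).
- exact: set_chainS (subD1set S Q) chS.
- by move: cS; rewrite (cardsD1 Q) QS => -[].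
exists (fun i => if i <= n then A i else Q); split=> i lein.
  by case: leqP => [/AS/setD1P[] | _].
rewrite ltnS in lein; rewrite lein; case: ltnP => [/ltA // | _].
have /setD1P[neq AiS] := AS i lein.
by rewrite properEneq neq maxQ.
Qed.

(** Along a chain, each step is seen by the intersection with [X] or by the
    union with [X]. *)
Lemma set_chain_split S X : set_chain S ->
  #|S| <= #|[set Y :&: X | Y in S]| + #|[set Y :|: X | Y in S]|.
Proof.
have [n] := ubnP #|S|; elim: n S => // n IHn S leSn chS.
have [-> | S0] := eqVneq S set0; first by rewrite cards0.
have [Q QS maxQ] := set_chain_max chS S0.
have chS' := set_chainS (subD1set S Q) chS.
have {IHn} := IHn (S :\ Q); rewrite (cardsD1 Q S) QS in leSn *; move=> /(_ leSn chS').
set I' := [set _ | _ in S :\ Q]; set U' := [set _ | _ in S :\ Q].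
have -> : [set Y :&: X | Y in S] = (Q :&: X) |: I' by rewrite -{1}(setD1K QS) imsetU1.
have -> : [set Y :|: X | Y in S] = (Q :|: X) |: U' by rewrite -{1}(setD1K QS) imsetU1.
rewrite !cardsU1; suff : ~~ ((Q :&: X \in I') && (Q :|: X \in U')).
  by case: (_ \in I'); case: (_ \in U') => //= _; lia.
apply/negP => /andP[/imsetP[Y1 Y1S eq1] /imsetP[Y2 Y2S eq2]].
have noZ Z : Z \in S :\ Q -> Y1 \subset Z -> Y2 \subset Z -> False.
  move=> /setD1P[neqZ ZS] s1 s2; case/eqP: neqZ; apply/setP => x.
  apply/idP/idP => [|xQ]; first exact: subsetP (maxQ Z ZS) x.
  have [xX | xX] := boolP (x \in X).
    have : x \in Q :&: X by rewrite inE xQ.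
    by rewrite eq1 inE => /andP[/(subsetP s1)].
  have : x \in Q :|: X by rewrite inE xQ.
  by rewrite eq2 inE (negbTE xX) orbF => /(subsetP s2).
have /orP[s12 | s21] := chS' Y1 Y2 Y1S Y2S.
- exact: noZ Y2S s12 (subxx _).
- exact: noZ Y1S (subxx _) s21.
Qed.

End Chains.

(** Here [m] bounds the linked chains, and [d] is the number of orders that may
    occur strictly between the ends of the chain. The summand 2 stands for the
    ends, which may have a lower order. *)
Fixpoint chain_bound m d := if d is d'.+1 then m.+1 * chain_bound m d' + 2 else 2.

Section BoundedOrder.
Variables (T : finType) (M : matroid T) (K m : nat).
Hypothesis linked_lt :
  forall (A : nat -> {set T}) n t, t <= K -> linked_chain M A n t -> n < m.
Implicit Types (P Q X Y Z : {set T}) (S : {set {set T}}).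
Local Notation E := (ground M).
Local Notation lam := (connectivity M).

Definition chain_between P Q S :=
  set_chain S /\ {in S, forall Y, [/\ P \subset Y, Y \subset Q & lam Y <= K]}.

Let bounded_between d := forall P Q S, Q \subset E -> chain_between P Q S ->
  (forall X, P \subset X -> X \subset Q -> X != P -> X != Q -> K < lam X + d) ->
  #|S| <= chain_bound m d.

(** Cut at a minimal set [X] of order [K - d], the least possible order: below
    [X] only larger orders occur, and above [X] the chains of sets of order
    [K - d] are shorter. Submodularity keeps the orders at most [K]. *)
Lemma chain_cut d (bounded : bounded_between d) m' P Q S :
    Q \subset E -> chain_between P Q S ->
    (forall X, P \subset X -> X \subset Q -> K - d <= lam X) ->
    (forall S', set_chain S' ->
       {in S', forall X, [/\ P \proper X, X \subset Q & lam X = K - d]} -> #|S'| <= m') ->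
  #|S| <= m'.+1 * chain_bound m d.
Proof.
elim: m' P Q S => [|m' IHm] P Q S sQE [chS btwS] minl maxS'.
  rewrite mul1n; apply: (bounded P Q) => // X sPX sXQ neqP neqQ.
  have leX := minl X sPX sXQ; suff : lam X != K - d by lia.
  apply/eqP => eqX; suff : #|[set X]| <= 0 by rewrite cards1.
  apply: maxS'.
  - by move=> Y Z; rewrite !inE => /eqP-> /eqP->; rewrite subxx.
  - by move=> Y; rewrite inE => /eqP->; rewrite properEneq eq_sym neqP.
pose tset X := [&& P \proper X, X \subset Q & lam X == K - d].
have [X0 tX0 | no_t] := pickP tset; last first.
  apply: (@leq_trans (chain_bound m d)); last by rewrite mulSn leq_addr.
  apply: (bounded P Q) => // X sPX sXQ neqP neqQ.
  have leX := minl X sPX sXQ; suff : lam X != K - d by lia.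
  by have := no_t X; rewrite /tset properEneq eq_sym neqP sPX sXQ => /negbT.
have [X /and3P[ltPX sXQ /eqP lX] minX] := arg_minnP (fun Y : {set T} => #|Y|) tX0.
have sPX := proper_sub ltPX; have sXE := subset_trans sXQ sQE.
rewrite mulSn; apply: leq_trans (set_chain_split X chS) _; apply: leq_add.
  apply: (bounded P X) => //.
    split; first by apply: set_chain_image chS => Y Z; apply: setSI.
    move=> _ /imsetP[Y YS ->]; have [sPY sYQ lY] := btwS Y YS.
    rewrite subsetI sPY sPX subsetIr; split=> //.
    have sUQ : Y :|: X \subset Q by rewrite subUset sYQ.
    have := minl _ (subset_trans sPX (subsetUr Y X)) sUQ.
    have := connectivity_submod (subset_trans sYQ sQE) sXE.
    by rewrite lX; move: lY; clear; lia.
  move=> Z sPZ sZX neqP neqX; have leZ := minl Z sPZ (subset_trans sZX sXQ).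
  suff : lam Z != K - d by lia.
  apply/negP => lZ; have := minX Z; rewrite /tset properEneq eq_sym neqP sPZ lZ.
  rewrite (subset_trans sZX sXQ) => /(_ isT); apply/negP; rewrite -ltnNge.
  by apply: proper_card; rewrite properEneq neqX.
apply: (IHm X Q) => //.
- split; first by apply: set_chain_image chS => Y Z; apply: setSU.
  move=> _ /imsetP[Y YS ->]; have [sPY sYQ lY] := btwS Y YS.
  rewrite subUset sYQ sXQ subsetUr; split=> //.
  have sPI : P \subset Y :&: X by rewrite subsetI sPY.
  have := minl _ sPI (subset_trans (subsetIr Y X) sXQ).
  have := connectivity_submod (subset_trans sYQ sQE) sXE.
  by rewrite lX; move: lY; clear; lia.
- by move=> Y sXY; apply: minl; apply: subset_trans sXY.
move=> S' chS' btw'.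
have XS' : X \notin S' by apply/negP => /btw'[]; rewrite properxx.
suff : #|X |: S'| <= m'.+1 by rewrite cardsU1 XS'.
apply: maxS'.
- move=> Y Z /setU1P[-> | YS'] /setU1P[-> | ZS'].
  + by rewrite subxx.
  + by have [/proper_sub-> _ _] := btw' Z ZS'.
  + by have [/proper_sub-> _ _] := btw' Y YS'; rewrite orbT.
  + exact: chS'.
- move=> Y /setU1P[-> // | YS']; have [ltXY sYQ lY] := btw' Y YS'.
  by split=> //; apply: proper_trans ltXY.
Qed.

(** Once the ends [P] and [Q] are dropped, all the sets between the remaining
    extreme members have order at least [K - d], and those of order exactly
    [K - d] form linked chains. *)
Lemma chain_between_bound d : bounded_between d.
Proof.
elim: d => [|d IHd] P Q S sQE [chS btwS] minl.
  apply: leq_trans (subset_leq_card (_ : S \subset [set P; Q])) _.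
    apply/subsetP => Y YS; have [sPY sYQ lY] := btwS Y YS; rewrite !inE.
    apply/negPn; rewrite negb_or; apply/negP => /andP[neqP neqQ].
    by have := minl Y sPY sYQ neqP neqQ; lia.
  by rewrite cards2; case: (P != Q).
pose S' := S :\: [set P; Q].
have sS' : S' \subset S by apply: subsetDl.
have chS' := set_chainS sS' chS.
have -> : chain_bound m d.+1 = m.+1 * chain_bound m d + 2 by [].
have : #|S| <= #|S'| + 2.
  rewrite -(cardsID [set P; Q] S) addnC leq_add2l.
  apply: leq_trans (subset_leq_card (subsetIr _ _)) _.
  by rewrite cards2; case: (P != Q).
move/leq_trans; apply; rewrite leq_add2r.
have [-> | S'0] := eqVneq S' set0; first by rewrite cards0.
have [P' P'S minP'] := set_chain_min chS' S'0.
have [Q' Q'S maxQ'] := set_chain_max chS' S'0.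
have [/btwS[sPP' _ _] neqP'P] : P' \in S /\ P' != P.
  by move: P'S; rewrite !inE negb_or => /andP[/andP[]].
have [/btwS[_ sQ'Q _] neqQ'Q] : Q' \in S /\ Q' != Q.
  by move: Q'S; rewrite !inE negb_or => /andP[/andP[]].
have minl' X : P' \subset X -> X \subset Q' -> K - d <= lam X.
  move=> sP'X sXQ'; have := minl X (subset_trans sPP' sP'X) (subset_trans sXQ' sQ'Q).
  have -> : X != P.
    by apply: contra neqP'P => /eqP eqX; rewrite eqEsubset sPP' -{1}eqX sP'X.
  have -> : X != Q.
    by apply: contra neqQ'Q => /eqP eqX; rewrite eqEsubset sQ'Q -{1}eqX sXQ'.
  by move=> /(_ isT isT); lia.
apply: (@chain_cut d IHd m P' Q') => //.
- exact: subset_trans sQ'Q sQE.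
- split=> // Y YS'; have [_ _ lY] := btwS Y (subsetP sS' Y YS').
  by rewrite minP' ?maxQ'.
move=> S2 chS2 btw2; case eq2: #|S2| => [|n] //.
have [A [AS ltA]] := set_chain_enum chS2 eq2.
apply: (@linked_lt A n (K - d)); first exact: leq_subr.
split=> // [i lein | i lein | i X ltin sAX sXA].
- have [_ sA _] := btw2 _ (AS i lein).
  exact: subset_trans sA (subset_trans sQ'Q sQE).
- by have [] := btw2 _ (AS i lein).
have [/proper_sub sPA _ _] := btw2 _ (AS i (ltnW ltin)).
have [_ sAQ _] := btw2 _ (AS i.+1 ltin).
by apply: minl'; [apply: subset_trans sAX | apply: subset_trans sAQ].
Qed.

Theorem bounded_order_chain S : set_chain S ->
    {in S, forall Y, Y \subset E /\ lam Y <= K} ->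
  #|S| <= chain_bound m K.+1.
Proof.
move=> chS btwS; apply: (@chain_between_bound _ set0 E) => //.
  by split=> // Y /btwS[]; rewrite sub0set.
by move=> X _ _ _ _; lia.
Qed.

End BoundedOrder.

(** * Long chains in cubic trees *)

Section CubicTree.
Variables (V : finType) (e : rel V).
Hypothesis cubic : is_cubic_tree e.
Implicit Types (u v w x y z : V).

Lemma tree_sym : symmetric e.
Proof. by case: cubic => -[]. Qed.

Lemma tree_neq x y : e x y -> x != y.
Proof. by case: cubic => -[_ irr _ _ _] _; apply: contraTneq => ->; rewrite irr. Qed.

Lemma set2_eqr x y z : ([set x; z] == [set x; y]) = (z == y).
Proof.
apply/eqP/eqP => [eqs | -> //].
have : z \in [set x; y] by rewrite -eqs set22.
rewrite !inE => /orP[/eqP zx | /eqP //].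
have : y \in [set x; z] by rewrite eqs set22.
by rewrite !inE zx orbb => /eqP->.
Qed.

Lemma remove_edge_sym x y : symmetric (remove_edge e x y).
Proof. by move=> u v; rewrite /remove_edge /= tree_sym setUC. Qed.

Lemma edge_bridge x y : e x y -> ~~ connect (remove_edge e x y) x y.
Proof.
move=> exy; apply/negP => /connectP[p pathp lastp].
move: lastp; case: (shortenP pathp) => p' pathp' uniqp' _ lastp.
case: cubic => -[_ _ _ _ acyc] _; apply: (acyc (x :: p')).
  case: p' lastp pathp' {uniqp'} => [eqy | z [|z' p'']] //=.
    by have := tree_neq exy; rewrite eqy eqxx.
  by move=> -> ; rewrite /remove_edge /= eqxx andbF.
rewrite /ucycle uniqp' andbT /= rcons_path -lastp tree_sym exy andbT.
by apply: sub_path pathp' => a b /andP[].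
Qed.

(** A path from [z] to [x] without the edge [z x] would close a cycle, so that the
    component of [z] does not meet [x]. *)
Lemma connect_avoid x z u : e x z -> u \in edge_component e z x ->
  connect [rel a b | [&& e a b, a != x & b != x]] z u.
Proof.
move=> exz; rewrite inE => /connectP[p pathp ->].
have xp : x \notin z :: p.
  apply/negP => /(path_connect pathp); apply/negP/edge_bridge.
  by rewrite tree_sym.
apply/connectP; exists p => //.
apply: (sub_in_path (P := predC1 x)) pathp.
  by move=> a b; rewrite !inE => ax bx /andP[eab _] /=; rewrite eab ax bx.
by apply/allP => a ap; apply: contraNneq xp => <-.
Qed.

Lemma avoid_remove x w : subrel [rel a b | [&& e a b, a != x & b != x]] (remove_edge e w x).
Proof.
move=> a b /and3P[eab ax bx]; rewrite /remove_edge /= eab /=.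
apply/negP => /eqP/setP/(_ x); rewrite !inE eqxx orbT.
by rewrite !(eq_sym x) (negbTE ax) (negbTE bx).
Qed.

Lemma remove_edgeC x y : remove_edge e x y =2 remove_edge e y x.
Proof. by move=> a b; rewrite /remove_edge /= (setUC [set x]). Qed.

Lemma notin_edge_component x z : e x z -> x \notin edge_component e z x.
Proof. by move=> exz; rewrite inE edge_bridge // tree_sym. Qed.

Lemma edge_component_sub x y z : e x y -> e x z -> z != y ->
  edge_component e z x \subset edge_component e x y.
Proof.
move=> exy exz zy; apply/subsetP => u /(connect_avoid exz) conn_zu.
rewrite inE; apply: connect_trans (_ : connect _ z u).
  by apply: connect1; rewrite /remove_edge /= exz set2_eqr zy.
rewrite (eq_connect (remove_edgeC x y)).
by apply: connect_sub conn_zu => a b /(@avoid_remove x y)/connect1.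
Qed.

Lemma edge_component_disjoint x z z' : e x z -> e x z' -> z != z' ->
  [disjoint edge_component e z x & edge_component e z' x].
Proof.
move=> exz exz' neqz; rewrite -setI_eq0; apply/eqP/setP => u; rewrite !inE.
apply/negP => /andP[zu z'u].
have := edge_bridge (_ : e z x); rewrite tree_sym => /(_ exz)/negP; apply.
apply: connect_trans zu _.
have : connect (remove_edge e z x) z' u.
  have : u \in edge_component e z' x by rewrite inE.
  move/(connect_avoid exz'); apply: connect_sub => a b.
  by move/(@avoid_remove x z)/connect1.
rewrite (sym_connect_sym (@remove_edge_sym z x)).
move/connect_trans; apply; apply: connect1.
by rewrite /remove_edge /= tree_sym exz' (setUC [set z]) setUC set2_eqr eq_sym.
Qed.

Lemma edge_component_cover x u : u != x ->
  exists2 z, e x z & u \in edge_component e z x.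
Proof.
move=> ux; case: cubic => -[_ _ _ conn_e _] _.
have /connectP[p pathp lastp] := conn_e x u.
move: lastp; case: (shortenP pathp) => -[|z p'] /=.
  by move=> _ _ _ eqx; rewrite eqx eqxx in ux.
move=> /andP[exz pathp'] /andP[xp' _] _ ->; exists z => //; rewrite inE.
apply: connect_sub (_ : connect [rel a b | [&& e a b, a != x & b != x]] z (last z p')).
  by move=> a b /(@avoid_remove x z)/connect1.
apply/connectP; exists p' => //; apply: (sub_in_path (P := predC1 x)) pathp'.
  by move=> a b; rewrite !inE => ax bx eab /=; rewrite eab ax bx.
by apply/allP => a ap; apply: contraNneq xp' => <-.
Qed.

Lemma edge_component_split x y u : e x y -> u \in edge_component e x y -> u != x ->
  exists z, [/\ e x z, z != y & u \in edge_component e z x].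
Proof.
move=> exy uC ux; have [z exz uz] := edge_component_cover ux.
exists z; split=> //; apply: contraL uC => /eqP eqz; rewrite eqz in uz.
have eyx : e y x by rewrite tree_sym.
apply/negP; rewrite inE => xu; have /negP := edge_bridge exy; apply.
apply: connect_trans xu _; rewrite (sym_connect_sym (@remove_edge_sym x y)).
by move: uz; rewrite inE (eq_connect (remove_edgeC y x)).
Qed.

Lemma leaf_neighbour x y z : x \in leaves e -> e x y -> e x z -> y = z.
Proof.
rewrite inE => /cards1P[w eqw] exy exz.
have : y \in [set w] by rewrite -eqw inE.
have : z \in [set w] by rewrite -eqw inE.
by rewrite !inE => /eqP-> /eqP.
Qed.

Lemma internal_neighbours x y : x \notin leaves e -> e x y ->
  exists z1 z2, [/\ z1 != z2, e x z1 /\ z1 != y, e x z2 /\ z2 != y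
                  & forall z, e x z -> z != y -> z = z1 \/ z = z2].
Proof.
case: cubic => _ deg3 /deg3; rewrite /degree (cardsD1 y) inE => + exy.
rewrite exy => -[/eqP/cards2P[z1 [z2 [neq eqs]]]].
have mem z : (z \in [set z1; z2]) = (z != y) && e x z by rewrite -eqs !inE.
exists z1, z2; split=> //.
- by have := mem z1; rewrite !inE eqxx => /esym/andP[].
- by have := mem z2; rewrite !inE eqxx orbT => /esym/andP[].
by move=> z exz zy; have := mem z; rewrite exz zy !inE => /orP[] /eqP; [left | right].
Qed.

Lemma edge_component_leaf x y : e x y ->
  exists2 u, u \in leaves e & u \in edge_component e x y.
Proof.
have [n] := ubnP #|edge_component e x y|; elim: n x y => // n IHn x y leC exy.
have xC : x \in edge_component e x y by rewrite inE connect0.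
have [xl | xl] := boolP (x \in leaves e); first by exists x.
have [z [_ [_ [exz zy] _ _]]] := internal_neighbours xl exy.
have sC := edge_component_sub exy exz zy.
have [||u ul uC] := IHn z x _; last by exists u => //; apply: (subsetP sC).
  rewrite ltnS in leC; apply: leq_trans leC; apply: proper_card.
  by apply/properP; split=> //; exists x => //; apply: notin_edge_component.
by rewrite tree_sym.
Qed.

Variables (T : finType) (lab : V -> T).
Hypothesis lab_inj : {in leaves e &, injective lab}.

Definition side x y : {set T} := lab @: (leaves e :&: edge_component e x y).

Lemma side_neq0 x y : e x y -> side x y != set0.
Proof.
move=> /edge_component_leaf[u ul uC]; apply/set0Pn; exists (lab u).
by rewrite imset_f // inE ul.
Qed.

Lemma side_proper x y z z' : e x y -> e x z -> z != y -> e x z' -> z' != y ->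
  z != z' -> side z x \proper side x y.
Proof.
move=> exy exz zy exz' zy' neqz; apply/properP; split.
  by apply: imsetS; apply: setIS; apply: edge_component_sub.
have ez'x : e z' x by rewrite tree_sym.
have [u ul uC] := edge_component_leaf ez'x; exists (lab u).
  by rewrite imset_f // inE ul (subsetP (edge_component_sub exy exz' zy')).
apply/imsetP => -[w /setIP[wl wC] /lab_inj eqw].
have := edge_component_disjoint exz exz' neqz; rewrite disjoint_subset => /subsetP/(_ w wC).
by rewrite inE -eqw ?uC.
Qed.

(** The leaves behind an edge that ends in an internal vertex are shared out
    between two branches, and each branch misses a leaf of the other. *)
Lemma side_halve x y n : e x y -> 1 < #|side x y| -> n.*2 < #|side x y| ->
  exists z, [/\ e z x, side z x \proper side x y & n < #|side z x|].
Proof.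
move=> exy gt1 gtn; have [xl | xl] := boolP (x \in leaves e).
  suff : #|side x y| <= 1 by rewrite leqNgt gt1.
  apply: leq_trans (leq_imset_card _ _) _.
  apply: leq_trans (subset_leq_card (_ : _ \subset [set x])) _; last by rewrite cards1.
  apply/subsetP => u /setIP[_ uC]; rewrite inE; apply: contraTT uC => ux.
  apply/negP => uC; have [z [exz zy _]] := edge_component_split exy uC ux.
  by rewrite (leaf_neighbour xl exz exy) eqxx in zy.
have [z1 [z2 [neq [exz1 z1y] [exz2 z2y] onlyz]]] := internal_neighbours xl exy.
have p1 := side_proper exy exz1 z1y exz2 z2y neq.
rewrite eq_sym in neq; have p2 := side_proper exy exz2 z2y exz1 z1y neq.
have cover : side x y \subset side z1 x :|: side z2 x.
  apply/subsetP => _ /imsetP[u /setIP[ul uC] ->].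
  have ux : u != x by apply: contraNneq xl => <-.
  have [z [exz zy uz]] := edge_component_split exy uC ux.
  rewrite inE; have [eqz | eqz] := onlyz z exz zy; rewrite eqz in uz.
    by rewrite imset_f // inE ul.
  by apply/orP; right; rewrite imset_f // inE ul.
have := subset_leq_card cover; have := cardsU (side z1 x) (side z2 x).
have [lt1 | le1] := ltnP n #|side z1 x|; first by exists z1; rewrite tree_sym exz1.
have [lt2 | le2] := ltnP n #|side z2 x|; first by exists z2; rewrite tree_sym exz2.
by move: gtn le1 le2; rewrite -addnn; clear; lia.
Qed.

Lemma side_chain d x y : e x y -> 2 ^ d < #|side x y| ->
  exists S : {set {set T}}, [/\ set_chain S, #|S| = d.+1
    & {in S, forall X : {set T}, X \subset side x y /\ exists u v, e u v /\ X = side u v}].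
Proof.
elim: d x y => [|d IHd] x y exy.
  move=> _; exists [set side x y]; split; last 1 first.
  - by move=> X; rewrite inE => /eqP->; split=> //; exists x, y.
  - by move=> X Y; rewrite !inE => /eqP-> /eqP->; rewrite subxx.
  - by rewrite cards1.
rewrite expnS mul2n => ltd.
have gt1 : 1 < #|side x y| by apply: leq_ltn_trans ltd; rewrite double_gt0 expn_gt0.
have [z [ezx ltz gtz]] := side_halve exy gt1 ltd.
have [S [chS cS sideS]] := IHd z x ezx gtz.
have notS : side x y \notin S.
  by apply/negP => /sideS[sX _]; have := proper_subn ltz; rewrite sX.
have subS X : X \in S -> X \subset side x y.
  by move=> /sideS[sX _]; apply: subset_trans sX (proper_sub ltz).
exists (side x y |: S); split.
- move=> X Y /setU1P[-> | XS] /setU1P[-> | YS].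
  + by rewrite subxx.
  + by rewrite subS ?orbT.
  + by rewrite subS.
  + exact: chS.
- by rewrite cardsU1 notS cS.
move=> X /setU1P[-> | XS]; first by split=> //; exists x, y.
by split; [exact: subS | have [_] := sideS X XS].
Qed.

Lemma tree_chain d : 2 ^ d.+1 < #|lab @: leaves e| ->
  exists S : {set {set T}}, [/\ set_chain S, #|S| = d.+1
    & {in S, forall X : {set T}, exists u v, e u v /\ X = side u v}].
Proof.
move=> ltd; have /set0Pn[_ /imsetP[x xl _]] : lab @: leaves e != set0.
  by rewrite -card_gt0; apply: leq_ltn_trans ltd.
have [y exy] : exists y, e x y.
  by move: xl; rewrite inE => /cards1P[y /setP/(_ y)]; rewrite !inE eqxx; exists y.
have eyx : e y x by rewrite tree_sym.
have cover : lab @: leaves e \subset lab x |: side y x.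
  apply/subsetP => _ /imsetP[u ul ->]; rewrite !inE.
  have [-> | ux] := eqVneq u x; first by rewrite eqxx.
  have [z exz uz] := edge_component_cover ux.
  rewrite -(leaf_neighbour xl exy exz) in uz.
  by apply/orP; right; rewrite imset_f // inE ul.
have [|S [chS cS sideS]] := @side_chain d y x eyx.
  have := subset_leq_card cover; rewrite cardsU1; move: ltd; rewrite expnS.
  have := expn_gt0 2 d; case: (_ \notin _) => /=; lia.
by exists S; split=> // X /sideS[].
Qed.

End CubicTree.

Lemma branch_width_chain (T : finType) (M : matroid T) k d :
    has_branch_width M k -> 2 ^ d.+1 < #|ground M| ->
  exists S : {set {set T}}, [/\ set_chain S, #|S| = d.+1
    & {in S, forall X : {set T}, [/\ X \subset ground M, X != set0 & connectivity M X < k]}].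
Proof.
rewrite /has_branch_width => + ltd.
rewrite leqNgt (leq_ltn_trans _ ltd) ?expn_gt0 //= => -[[D widthD] _].
have [|S [chS cS sideS]] := @tree_chain _ _ (bd_cubic D) _ _ (@bd_label_inj _ _ D) d.
  by rewrite bd_label_onto.
exists S; split=> // X /sideS[u [v [euv ->]]]; split.
- by rewrite -(bd_label_onto D); apply: imsetS; apply: subsetIl.
- by apply: side_neq0 euv; apply: bd_cubic.
rewrite -widthD /width.
exact: (@leq_bigmax_cond _ (fun p => bd_edge p.1 p.2) (fun p => edge_width p.1 p.2) (u, v)).
Qed.

(** * The numerical bound *)

Lemma chain_bound_le m d : chain_bound m d + 2 <= 4 * m.+2 ^ d.
Proof.
elim: d => [|d IHd] //=; rewrite expnS.
have : 0 < m.+2 ^ d by rewrite expn_gt0.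
move: (chain_bound m d) (m.+2 ^ d) IHd => g p; nia.
Qed.

(** The bound of [linked_chain_bound]. *)
Definition link_length q t := 2 ^ (2 * (q ^ (t * t)) ^ 3 + 2).

Lemma link_length_mono q t t' : 0 < q -> t <= t' -> link_length q t <= link_length q t'.
Proof.
move=> q0 lett; rewrite /link_length leq_exp2l // leq_add2r leq_mul2l /=.
by rewrite leq_exp2r // leq_pexp2l // leq_mul.
Qed.

Lemma tower_bound q k : 1 < q -> 1 < k ->
  2 ^ (chain_bound (link_length q k.-1).+1 k).+1 <= tower [:: 3; q; q; k; 6].
Proof.
move=> q1 k1 /=; rewrite expn1; have q0 := ltnW q1.
set G := chain_bound _ k; set N := q ^ _.
suff leG : G.+1 <= N.
  apply: leq_trans (_ : 3 ^ G.+1 <= _); first by rewrite leq_exp2r.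
  by rewrite leq_exp2l.
set Q := (q ^ (k.-1 * k.-1)) ^ 3.
have Q0 : 0 < Q by rewrite !expn_gt0 q0.
apply: (@leq_trans (2 ^ ((2 * Q + 3) * k + 2))).
  have := chain_bound_le (link_length q k.-1).+1 k; rewrite -/G => leG.
  apply: (@leq_trans (4 * (link_length q k.-1).+3 ^ k)); first by apply: leq_trans leG; rewrite addn2.
  rewrite addnC expnD leq_mul // expnM leq_exp2r ?(ltnW k1) //.
  have : 2 ^ 2 <= link_length q k.-1 by rewrite leq_exp2l // leq_addl.
  have -> : 2 ^ (2 * Q + 3) = 2 * link_length q k.-1 by rewrite -expnS -addnS.
  by move: (link_length _ _) => p; clear; lia.
apply: (@leq_trans (q ^ ((2 * Q + 3) * k + 2))); first by rewrite leq_exp2r // addn2.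
rewrite leq_exp2l //.
apply: (@leq_trans (2 ^ 3 * Q * 2 ^ k)).
  have := ltn_expl k (ltnSn 1); move: (2 ^ k) => p; nia.
apply: (@leq_trans (q ^ (3 + k.-1 * k.-1 * 3 + k))).
  by rewrite !expnD !leq_mul ?leq_exp2r // /Q ?expnM // (ltnW k1).
rewrite leq_exp2l //; case: k k1 {G N Q Q0} => [//|k] /= k1.
rewrite !expnS expn0 muln1; nia.
Qed.

Theorem corollary1p3 (F : finFieldType) (q k : nat) (T : finType) (M : matroid T)
    (hq : #|F| = q) (hk : 0 < k)
    (hM : excluded_minor (@representable T F) M)
    (hbw : has_branch_width M k) :
  #|ground M| <= tower [:: 3; q; q; k; 6].
Proof.
have q1 : 1 < q by rewrite -hq; apply: card_finNzRing_gt1.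
have q0 := ltnW q1.
have [k1 | k1] := leqP k 1.
  have {hk k1} eqk : k = 1 by apply/eqP; rewrite eqn_leq k1.
  apply: (@leq_trans (2 ^ 2)); last first.
    rewrite eqk /= !exp1n !expn1 -[2 ^ 2]/4; apply: (@leq_trans (3 ^ 2)) => //.
    by rewrite leq_exp2l // (leq_trans q1) // -{1}(expn1 q) leq_exp2l.
  rewrite leqNgt; apply/negP => /(branch_width_chain hbw)[S [_ cS lamS]].
  have [X] : exists2 X, X \in S & X != ground M.
    have /card_gt0P[X] : 0 < #|S :\ ground M|.
      move: cS; rewrite (cardsD1 (ground M)); case: (ground M \in S).
        by rewrite add1n => -[->].
      by rewrite add0n => ->.
    by move=> /setD1P[neqX XS]; exists X.
  move=> /lamS[sX X0 lX] neqX; have := excluded_minor_connected hM sX X0 neqX.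
  by rewrite -lt0n; move: lX; rewrite eqk; clear; lia.
apply: leq_trans (tower_bound q1 k1).
rewrite leqNgt; apply/negP => /(branch_width_chain hbw)[S [chS cS lamS]].
have linked_lt (A : nat -> {set T}) n t :
    t <= k.-1 -> linked_chain M A n t -> n < (link_length q k.-1).+1.
  move=> letk chA; rewrite ltnS; apply: leq_trans (link_length_mono q0 letk).
  by rewrite /link_length -hq; apply: linked_chain_bound hM chA.
have small : {in S, forall X : {set T}, X \subset ground M /\ connectivity M X <= k.-1}.
  by move=> X /lamS[sX _ lX]; split=> //; rewrite -ltnS prednK.
by have := bounded_order_chain linked_lt chS small; rewrite cS prednK // ltnn.
Qed.
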